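(* For every integer $n\ge 7$ the $(n+2)$-point quadrature formula $$Q_{n+2}[f]=\frac{251}{192n}\sigma\Big(\frac1{2n}\Big)-\frac{43}{72n}\sigma\Big(\frac1n\Big)+\frac{127}{96n}\sigma\Big(\frac3{2n}\Big)+\frac{557}{576n}\sigma\Big(\frac5{2n}\Big)+\frac1n\sum_{k=4}^{n-3}f\Big(\frac{2k-1}{2n}\Big),\qquad \sigma(x):=f(x)+f(1-x),$$ is positive definite of order $4$, with error constant $$c_4(Q_{n+2})=\frac{1}{720\,n^4}\Big(1+\frac{445}{32\,n}\Big),$$ and the sequence $\{Q_{n+2}\}$ is asymptotically optimal positive definite of order $4$, i.e. $\lim_{n\to\infty}c_4(Q_{n+2})/c^{+}_{n+2,4}=1$.
   Context: An $N$-point quadrature formula is a functional $Q[f]=\sum_{i=1}^{N}a_i f(\tau_i)$ with nodes $0\le\tau_1<\dots<\tau_N\le 1$ and real weights; its remainder is $R[Q;f]=\int_0^1 f(x)\,dx-Q[f]$. $Q$ is positive definite of order $4$, with error constant $c_4(Q)$, if there is a constant $c_4(Q)>0$ such that for every $f\in C^4[0,1]$ there is $\xi\in[0,1]$ with $R[Q;f]=c_4(Q)f^{(4)}(\xi)$. $c^{+}_{N,4}$ denotes the infimum of $c_4(Q)$ over all $N$-point positive definite quadrature formulae $Q$ of order $4$. *)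

(* Defs.v *)
From Stdlib Require Import Reals.
From Coquelicot Require Import Coquelicot.
Open Scope R_scope.

(* Functions on [0,1] are represented by total functions R -> R; every notion
   below depends only on their values on [0,1]. *)
Definition I01 (x : R) : Prop := 0 <= x <= 1.

(* f belongs to C^4[0,1] and f4 is its fourth derivative on [0,1]. D_in and
   continue_in are relative to I01, hence one-sided at 0 and 1. *)
Definition C4_with (f f4 : R -> R) : Prop :=
  exists f1 f2 f3 : R -> R, forall x, I01 x ->
    D_in f f1 I01 x /\ D_in f1 f2 I01 x /\ D_in f2 f3 I01 x /\
    D_in f3 f4 I01 x /\ continue_in f4 I01 x.

(* sum_n_m u 1 N is u 1 + ... + u N. *)
Definition is_quadrature (N : nat) (Q : (R -> R) -> R) : Prop :=
  exists a tau : nat -> R,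
    (forall i, (1 <= i <= N)%nat -> I01 (tau i)) /\
    (forall i j, (1 <= i)%nat -> (i < j)%nat -> (j <= N)%nat ->
       tau i < tau j) /\
    (forall f : R -> R, Q f = sum_n_m (fun i => a i * f (tau i)) 1 N).

Definition remainder (Q : (R -> R) -> R) (f : R -> R) : R :=
  RInt f 0 1 - Q f.

Definition positive_definite4_with (Q : (R -> R) -> R) (c : R) : Prop :=
  0 < c /\
  forall f f4 : R -> R, C4_with f f4 ->
    exists xi : R, I01 xi /\ remainder Q f = c * f4 xi.

Definition positive_definite4 (Q : (R -> R) -> R) : Prop :=
  exists c : R, positive_definite4_with Q c.

(* When Q is positive definite the constant is unique (test with f = x^4),
   and iota selects it; otherwise the value is meaningless. *)
Definition c4 (Q : (R -> R) -> R) : R :=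
  iota (fun c : R => positive_definite4_with Q c).

(* The infimum is taken in the extended reals. It is finite as soon as an
   N-point positive definite formula exists, because 0 is a lower bound. *)
Definition cplus4 (N : nat) : R :=
  real (Glb_Rbar (fun c : R => exists Q : (R -> R) -> R,
    is_quadrature N Q /\ positive_definite4 Q /\ c = c4 Q)).

Definition sigma (f : R -> R) (x : R) : R := f x + f (1 - x).

(* The formula Q_{n+2}, indexed by n; it is meant for 7 <= n. *)
Definition Qf (n : nat) (f : R -> R) : R :=
  251 / (192 * INR n) * sigma f (1 / (2 * INR n))
  - 43 / (72 * INR n) * sigma f (1 / INR n)
  + 127 / (96 * INR n) * sigma f (3 / (2 * INR n))
  + 557 / (576 * INR n) * sigma f (5 / (2 * INR n))
  + 1 / INR n *
      sum_n_m (fun k => f ((2 * INR k - 1) / (2 * INR n))) 4 (n - 3).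

(* Main.v *)
Require Import Defs.
From Stdlib Require Import Reals Lra Lia Classical ClassicalEpsilon Arith Wf_nat Bool.
From Coquelicot Require Import Coquelicot.
Open Scope R_scope.

(** Positive definiteness.  The remainder of Q_{n+2} is the integral of f''''
    against its Peano kernel K.  With h = 1/n, K equals
    (t - a)^2 (t - a - h)^2 / 24 between two consecutive nodes a and a + h of
    the interior, is the mirror image of itself under t -> 1 - t, and on
    [0, 5h/2] consists of four explicit nonnegative quartics that join the
    interior pattern.  Integrating by parts on each piece
    ([peano_piece]) gives R[f] >= 0 whenever f'''' >= 0.  Subtracting multiples
    of x^4/24 then squeezes R[f] between c min f'''' and c max f'''', where
    c = R[x^4/24] ([Qf_positive_definite]), and the intermediate value theorem
    finishes.

    Asymptotic optimality.  It suffices that every positive definite formula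
    with N nodes satisfies c4(Q) >= 1 / (720 (N+9)^4)
    ([error_constant_lower_bound]).  The kernel K >= 0 has
    K'''' = 1 - sum a_i delta(tau_i) and c4(Q) is its integral.  If all weights
    were nonnegative, then
      int K = int K''^2 + sum a_i K(tau_i) >= int K''^2,
    and on a gap of length l between nodes K'' is a monic (up to the factor 1/2)
    quadratic, whose square has integral at least l^5/720, the value for the
    Legendre polynomial; convexity of l^5 gives the bound.  For weights of
    arbitrary sign K is replaced by the solution g of an obstacle problem:
    g minimizes int g''^2 / 2 - int g among the functions g <= K.  Then
    g'''' = 1 - nu with a measure nu >= 0 carried by the contact set {g = K},
    so that
      int K >= int g = int g''^2 + int K dnu >= int g''^2,
    and it remains to see that nu has at most N + O(1) atoms.  This is a count of
    the zeros of w = K - g >= 0: between two components of the contact set w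
    vanishes doubly at both ends, which forces a node with positive load w''''
    strictly between them ([gap_positive_load]); after a component of positive
    length, whose two ends may both be atoms of nu, w leaves with a triple zero,
    which forces a second node ([gap_negative_load]).  Hence, up to a bounded
    number of exceptions, each atom of nu can be charged to a node of its own
    ([counting_from]).

    The obstacle problem is solved on the grid j/m, where it is a
    finite-dimensional quadratic program: derivatives become differences, the
    nodes are rounded to grid points, and the resulting errors are of relative
    order 1/m.  Letting m tend to infinity gives the bound for c4(Q). *)

(** * Sums and second differences *)

(** f 0 + ... + f (n - 1); a sum over the half-open range [a, b) is written
    psum f b - psum f a. *)
Fixpoint psum (f : nat -> R) (n : nat) : R :=
  match n with O => 0 | S k => psum f k + f k end.

(** Second difference centred at j.  At j = 0 the convention pred 0 = 0 makes the
    telescoping in [psum_wronskian] valid from the first term on. *)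
Definition diff2 (w : nat -> R) (j : nat) : R := w (pred j) - 2 * w j + w (S j).

Lemma psum_ext f g n :
  (forall j, (j < n)%nat -> f j = g j) -> psum f n = psum g n.
Proof.
induction n as [|n IH]; intros H; simpl; [reflexivity|].
rewrite IH by (intros; apply H; lia). rewrite H by lia. reflexivity.
Qed.

Lemma psum_plus f g n : psum (fun j => f j + g j) n = psum f n + psum g n.
Proof. induction n as [|n IH]; simpl; [ring|rewrite IH; ring]. Qed.

Lemma psum_scal c f n : psum (fun j => c * f j) n = c * psum f n.
Proof. induction n as [|n IH]; simpl; [ring|rewrite IH; ring]. Qed.

Lemma psum_le f g n :
  (forall j, (j < n)%nat -> f j <= g j) -> psum f n <= psum g n.
Proof.
induction n as [|n IH]; intros H; simpl; [lra|].
assert (f n <= g n) by (apply H; lia).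
assert (psum f n <= psum g n) by (apply IH; intros; apply H; lia). lra.
Qed.

Lemma psum_mono f a b :
  (forall j, 0 <= f j) -> (a <= b)%nat -> psum f a <= psum f b.
Proof.
intros Hf Hab. induction Hab as [|b Hab IH]; [lra|]. simpl. specialize (Hf b). lra.
Qed.

Lemma psum_ge_term f a b t :
  (forall j, 0 <= f j) -> (a <= t < b)%nat -> f t <= psum f b - psum f a.
Proof.
intros Hf [H1 H2].
pose proof (psum_mono f a t Hf H1). pose proof (psum_mono f (S t) b Hf H2).
simpl in *. lra.
Qed.

Lemma psum_ge_term2 f a b t u :
  (forall j, 0 <= f j) -> (a <= t < b)%nat -> (a <= u < b)%nat -> t <> u ->
  f t + f u <= psum f b - psum f a.
Proof.
intros Hf Ht Hu Htu.
assert (G : forall x y, (a <= x)%nat -> (x < y < b)%nat ->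
              f x + f y <= psum f b - psum f a).
{ intros x y Hx Hy.
  pose proof (psum_ge_term f a (S x) x Hf ltac:(lia)).
  pose proof (psum_ge_term f (S x) b y Hf ltac:(lia)). lra. }
destruct (Nat.lt_gt_cases t u) as [[H|H] _]; [lia| |].
- apply G; lia.
- rewrite Rplus_comm. apply G; lia.
Qed.

(** Squared norm on n points of a quadratic with leading coefficient 1/2, split into
    its discrete Legendre part (the first term), its slope b and its mean c. *)
Lemma psum_quadratic_sq al be n :
  let x := INR n in
  let b := be + (x - 2) / 2 in
  let c := al + b * (x - 1) / 2 - (x - 1) * (x - 2) / 12 in
  psum (fun i => (al + be * INR i + INR i * (INR i - 1) / 2) ^ 2) n
  = x * (x ^ 2 - 1) * (x ^ 2 - 4) / 720 + x * (x ^ 2 - 1) / 12 * b ^ 2 + x * c ^ 2.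
Proof.
induction n as [|n IH]; cbn zeta in *.
- simpl. field.
- cbn [psum]. rewrite IH, S_INR. field.
Qed.

Lemma psum_shift f a n :
  psum f (a + n) - psum f a = psum (fun i => f (a + i)%nat) n.
Proof.
induction n as [|n IH].
- rewrite Nat.add_0_r. simpl. ring.
- rewrite Nat.add_succ_r. simpl. rewrite <- IH. ring.
Qed.

Lemma diff2_one_quadratic v a n :
  (forall i, (0 < i)%nat -> (S i < n)%nat -> diff2 v (a + i) = 1) ->
  forall i, (i < n)%nat ->
    v (a + i)%nat
    = v a + (v (S a) - v a) * INR i + INR i * (INR i - 1) / 2.
Proof.
intros H.
assert (G : forall i, ((i < n)%nat -> v (a + i)%nat
    = v a + (v (S a) - v a) * INR i + INR i * (INR i - 1) / 2) /\
   ((S i < n)%nat -> v (a + S i)%nat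
    = v a + (v (S a) - v a) * INR (S i) + INR (S i) * (INR (S i) - 1) / 2)).
{ induction i as [|i [IH1 IH2]].
  - split; intros Hi.
    + rewrite Nat.add_0_r. simpl. field.
    + rewrite Nat.add_succ_r, Nat.add_0_r. simpl. field.
  - split; [exact IH2|]. intros Hi.
    specialize (H (S i) ltac:(lia) Hi). unfold diff2 in H.
    rewrite Nat.add_succ_r in H at 1. simpl pred in H.
    rewrite IH1, IH2 in H by lia.
    rewrite <- (Nat.add_succ_r a (S i)) in H.
    replace (v (a + S (S i))%nat) with
      (1 - (v a + (v (S a) - v a) * INR i + INR i * (INR i - 1) / 2)
       + 2 * (v a + (v (S a) - v a) * INR (S i) + INR (S i) * (INR (S i) - 1) / 2)) by lra.
    rewrite !S_INR. field. }
intros i. apply G.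
Qed.

(** Discrete form of int v^2 >= l^5/720 for v'' = 1 on an interval of length l. *)
Lemma segment_energy v a n :
  (forall i, (0 < i)%nat -> (S i < n)%nat -> diff2 v (a + i) = 1) ->
  INR n * (INR n ^ 2 - 1) * (INR n ^ 2 - 4) / 720
  <= psum (fun j => v j ^ 2) (a + n) - psum (fun j => v j ^ 2) a.
Proof.
intros H. rewrite psum_shift.
erewrite psum_ext.
2:{ intros j Hj. rewrite (diff2_one_quadratic v a n H j Hj). reflexivity. }
rewrite psum_quadratic_sq. cbn zeta.
set (b := _ + _ / 2). set (c := v a + b * _ / 2 - _).
assert (Hn : 0 <= INR n) by apply pos_INR.
assert (H1 : 0 <= INR n * (INR n ^ 2 - 1)).
{ destruct n as [|n]; [simpl; lra|]. rewrite S_INR. pose proof (pos_INR n). nra. }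
assert (0 <= INR n * (INR n ^ 2 - 1) / 12 * b ^ 2)
  by (apply Rmult_le_pos; [lra|apply pow2_ge_0]).
assert (0 <= INR n * c ^ 2) by (apply Rmult_le_pos; [lra|apply pow2_ge_0]).
lra.
Qed.

(** The tangent of x^5 at H: it replaces Jensen's inequality and makes the energy
    bounds additive in the length and in the number of segments. *)
Lemma tangent_pow5 x H : 0 <= x -> 0 <= H -> 5 * H ^ 4 * x - 4 * H ^ 5 <= x ^ 5.
Proof.
intros Hx HH.
replace (x ^ 5) with (5 * H ^ 4 * x - 4 * H ^ 5
  + (x - H) ^ 2 * (x ^ 3 + 2 * H * x ^ 2 + 3 * H ^ 2 * x + 4 * H ^ 3)) by ring.
assert (0 <= (x - H) ^ 2 * (x ^ 3 + 2 * H * x ^ 2 + 3 * H ^ 2 * x + 4 * H ^ 3)); [|lra].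
apply Rmult_le_pos; [apply pow2_ge_0|].
repeat apply Rplus_le_le_0_compat; repeat apply Rmult_le_pos; try apply pow_le; lra.
Qed.

Lemma segment_energy_linear v a n H :
  0 <= H ->
  (forall i, (0 < i)%nat -> (S i < n)%nat -> diff2 v (a + i) = 1) ->
  H ^ 4 / 144 * INR n - (H ^ 4 / 72 + H ^ 5 / 180)
  <= psum (fun j => v j ^ 2) (a + n) - psum (fun j => v j ^ 2) a.
Proof.
intros HH Hv. eapply Rle_trans; [|apply segment_energy, Hv].
assert (H4 : 0 <= H ^ 4) by (apply pow_le; lra).
assert (H5 : 0 <= H ^ 5) by (apply pow_le; lra).
destruct n as [|[|n]]; [simpl; lra|simpl; lra|].
rewrite !S_INR. set (y := INR n). assert (Hy : 0 <= y) by apply pos_INR.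
pose proof (tangent_pow5 y H Hy HH).
assert (y ^ 5 <= (y + 1 + 1) * ((y + 1 + 1) ^ 2 - 1) * ((y + 1 + 1) ^ 2 - 4)); [|lra].
assert (0 <= y ^ 2) by nra. assert (0 <= y ^ 3) by nra. assert (0 <= y ^ 4) by nra.
nra.
Qed.

(** * Counting the atoms of the contact measure *)

Lemma least_index (P : nat -> Prop) a b :
  (a <= b)%nat -> P b ->
  exists p, (a <= p <= b)%nat /\ P p /\ forall j, (a <= j < p)%nat -> ~ P j.
Proof.
induction b as [b IH] using lt_wf_ind. intros Hab Hb.
destruct (classic (exists j, (a <= j < b)%nat /\ P j)) as [[j [Hj Pj]]|Hno].
- destruct (IH j ltac:(lia) ltac:(lia) Pj) as [p [Hp [Pp Hmin]]].
  exists p. repeat split; [lia|lia|exact Pp|exact Hmin].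
- exists b. repeat split; [lia|lia|exact Hb|].
  intros j Hj Pj. apply Hno. exists j. auto.
Qed.

(** Minimum principle for discretely concave sequences. *)
Lemma concave_positive s a b :
  (forall j, (a < j < b)%nat -> diff2 s j <= 0) -> 0 < s a -> 0 < s b ->
  forall j, (a <= j <= b)%nat -> 0 < s j.
Proof.
intros Hc Ha Hb.
destruct (classic (exists j, (a <= j <= b)%nat /\ s j <= 0)) as [[j [Hj Sj]]|Hno].
2:{ intros j Hj. apply Rnot_le_lt. intros Sj. apply Hno. exists j. auto. }
exfalso.
destruct (least_index (fun i => s i <= 0) a j ltac:(lia) Sj) as [i [Hi [Si Hmin]]].
assert (Hai : (a < i)%nat).
{ destruct (Nat.eq_dec a i) as [E|]; [subst; lra|lia]. }
assert (Hstep : forall n, (i + n <= b)%nat ->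
          s (i + n)%nat <= 0 /\ s (i + n)%nat <= s (pred (i + n))).
{ induction n as [|n IH]; intros Hn.
  - rewrite Nat.add_0_r. split; [exact Si|].
    specialize (Hmin (pred i) ltac:(lia)). cbv beta in Hmin. lra.
  - destruct (IH ltac:(lia)) as [I1 I2].
    specialize (Hc (i + n)%nat ltac:(lia)). unfold diff2 in Hc.
    rewrite Nat.add_succ_r. simpl pred. lra. }
specialize (Hstep (b - i)%nat ltac:(lia)).
replace (i + (b - i))%nat with b in Hstep by lia. lra.
Qed.

(** Between two consecutive zeros q < p of w >= 0 some fourth difference is
    positive: otherwise the second difference would be concave and positive at both
    ends, so w would increase from q to p. *)
Lemma gap_positive_load w q p :
  (1 <= q)%nat -> (S q < p)%nat ->
  (forall j, 0 <= w j) -> w q = 0 -> w p = 0 ->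
  (forall j, (q < j < p)%nat -> 0 < w j) ->
  exists j, (q < j < p)%nat /\ 0 < diff2 (diff2 w) j.
Proof.
intros Hq Hqp Hw Wq Wp Hpos.
apply NNPP. intros Hno.
assert (Hc : forall j, (q < j < p)%nat -> diff2 (diff2 w) j <= 0).
{ intros j Hj. apply Rnot_lt_le. intros Hl. apply Hno. exists j. auto. }
assert (S1 : 0 < diff2 w q).
{ unfold diff2. rewrite Wq. specialize (Hw (pred q)). specialize (Hpos (S q) ltac:(lia)). lra. }
assert (S2 : 0 < diff2 w p).
{ unfold diff2. rewrite Wp. specialize (Hw (S p)). specialize (Hpos (pred p) ltac:(lia)). lra. }
pose proof (concave_positive (diff2 w) q p Hc S1 S2) as Hs.
assert (Hinc : forall n, (q + n < p)%nat -> 0 < w (q + S n)%nat - w (q + n)%nat).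
{ induction n as [|n IH]; intros Hn.
  - rewrite Nat.add_0_r, Wq. specialize (Hpos (q + 1)%nat ltac:(lia)). lra.
  - specialize (IH ltac:(lia)). specialize (Hs (q + S n)%nat ltac:(lia)).
    unfold diff2 in Hs. rewrite <- (Nat.add_succ_r q (S n)) in Hs.
    replace (pred (q + S n)) with (q + n)%nat in Hs by lia. lra. }
specialize (Hinc (p - q - 1)%nat ltac:(lia)).
replace (q + S (p - q - 1))%nat with p in Hinc by lia.
specialize (Hpos (q + (p - q - 1))%nat ltac:(lia)). lra.
Qed.

(** After four consecutive zeros ending at q, nonnegative fourth differences would
    keep w nondecreasing, so w could not return to 0 at p. *)
Lemma gap_negative_load w q p :
  (3 <= q)%nat -> (S q < p)%nat ->
  (forall i, (i <= 3)%nat -> w (q - i)%nat = 0) -> w p = 0 ->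
  (forall j, (q < j < p)%nat -> 0 < w j) ->
  exists j, (q - 1 <= j < p)%nat /\ diff2 (diff2 w) j < 0.
Proof.
intros Hq Hqp W0 Wp Hpos.
apply NNPP. intros Hno.
assert (Hc : forall j, (q - 1 <= j < p)%nat -> 0 <= diff2 (diff2 w) j).
{ intros j Hj. apply Rnot_lt_le. intros Hl. apply Hno. exists j. auto. }
destruct q as [|[|[|q]]]; try lia.
pose proof (W0 0%nat ltac:(lia)) as Z3. pose proof (W0 1%nat ltac:(lia)) as Z2.
pose proof (W0 2%nat ltac:(lia)) as Z1. pose proof (W0 3%nat ltac:(lia)) as Z0.
clear W0. simpl in Z0, Z1, Z2, Z3. rewrite ?Nat.sub_0_r in *.
assert (G : forall n, (q + n + 3 < p)%nat ->
   0 <= diff2 w (q + n + 2)%nat - diff2 w (q + n + 1)%nat /\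
   0 <= diff2 w (q + n + 2)%nat /\
   0 <= w (q + n + 3)%nat - w (q + n + 2)%nat).
{ induction n as [|n IH]; intros Hn.
  - rewrite Nat.add_0_r.
    replace (q + 2)%nat with (S (S q)) by lia. replace (q + 1)%nat with (S q) by lia.
    replace (q + 3)%nat with (S (S (S q))) by lia.
    unfold diff2. simpl pred. rewrite Z0, Z1, Z2, Z3. lra.
  - destruct (IH ltac:(lia)) as [I1 [I2 I3]].
    specialize (Hc (q + n + 2)%nat ltac:(lia)). unfold diff2 at 1 in Hc.
    replace (q + S n + 2)%nat with (S (q + n + 2)) by lia.
    replace (q + S n + 1)%nat with (q + n + 2)%nat by lia.
    replace (q + S n + 3)%nat with (S (q + n + 3)) by lia.
    replace (pred (q + n + 2)) with (q + n + 1)%nat in Hc by lia.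
    assert (0 <= diff2 w (S (q + n + 2)) - diff2 w (q + n + 2)%nat) by lra.
    assert (H2 : 0 <= diff2 w (S (q + n + 2))) by lra.
    repeat split; try lra.
    unfold diff2 in H2. simpl pred in H2.
    replace (S (S (q + n + 2))) with (S (q + n + 3)) in H2 by lia.
    replace (S (q + n + 2)) with (q + n + 3)%nat in * by lia. lra. }
specialize (G (p - q - 4)%nat ltac:(lia)).
replace (q + (p - q - 4) + 3)%nat with (pred p) in G by lia.
replace (q + (p - q - 4) + 2)%nat with (pred (pred p)) in G by lia.
(* the loads at q - 1, ..., p - 2 determine w up to p *)
assert (Hlast : 0 <= diff2 w (pred p)).
{ specialize (Hc (pred (pred p)) ltac:(lia)). unfold diff2 at 1 in Hc.
  replace (S (pred (pred p))) with (pred p) in Hc by lia.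
  replace (q + (p - q - 4) + 1)%nat with (pred (pred (pred p))) in G by lia. lra. }
unfold diff2 in Hlast. replace (S (pred p)) with p in Hlast by lia.
specialize (Hpos (pred p) ltac:(lia)). lra.
Qed.

(** Indicator function with real values. *)
Definition ind (T : nat -> bool) (j : nat) : R := if T j then 1 else 0.

Lemma ind_nonneg T j : 0 <= ind T j.
Proof. unfold ind. destruct (T j); lra. Qed.

Section Counting.
Variables (v : nat -> R) (T : nat -> bool) (A B : R).
(** Energy bound for segments on which the second difference of v is 1: linear in
    the length n, with a fixed cost B per segment. *)
Hypothesis A0 : 0 <= A.
Hypothesis B0 : 0 <= B.
Hypothesis Hseg : forall a n,
  (forall i, (0 < i)%nat -> (S i < n)%nat -> diff2 v (a + i) = 1) ->
  A * INR n - B <= psum (fun j => v j ^ 2) (a + n) - psum (fun j => v j ^ 2) a.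

Let E n := psum (fun j => v j ^ 2) n.
Let tau n := psum (ind T) n.

Lemma energy_mono a b : (a <= b)%nat -> E a <= E b.
Proof. apply psum_mono. intros; apply pow2_ge_0. Qed.

Lemma free_segment_energy a b :
  (a <= b)%nat -> (forall j, (a <= j < b)%nat -> diff2 v j = 1) ->
  A * (INR b - INR a) - B <= E b - E a.
Proof.
intros Hab H. specialize (Hseg a (b - a)%nat).
rewrite <- minus_INR by exact Hab.
replace (a + (b - a))%nat with b in Hseg by lia.
apply Hseg. intros i H1 H2. apply H. lia.
Qed.

(** A segment with k exceptional indices splits into k + 1 free ones. *)
Lemma segment_energy_with_nodes a b :
  (a <= b)%nat -> (forall j, (a <= j < b)%nat -> T j = false -> diff2 v j = 1) ->
  A * (INR b - INR a) - (B + 4 * A) * (1 + tau b - tau a) <= E b - E a.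
Proof.
induction b as [b IH] using lt_wf_ind. intros Hab H.
destruct (classic (exists t, (a <= t < b)%nat /\ T t = true)) as [[t0 [Ht0 Tt0]]|Hno].
- destruct (least_index (fun i => T (b - i)%nat = true) 1 (b - t0)) as [i [Hi [Ti Hmin]]].
  { lia. } { replace (b - (b - t0))%nat with t0 by lia. exact Tt0. }
  set (t := (b - i)%nat) in *.
  specialize (IH t ltac:(lia) ltac:(lia)).
  assert (I1 : A * (INR t - INR a) - (B + 4 * A) * (1 + tau t - tau a) <= E t - E a).
  { apply IH. intros j Hj. apply H. lia. }
  assert (I2 : A * (INR b - INR (S t)) - B <= E b - E (S t)).
  { apply free_segment_energy; [lia|]. intros j Hj. apply H; [lia|].
    specialize (Hmin (b - j)%nat ltac:(lia)).
    replace (b - (b - j))%nat with j in Hmin by lia.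
    destruct (T j); [exfalso; apply Hmin; reflexivity|reflexivity]. }
  pose proof (energy_mono t (S t) ltac:(lia)) as I3.
  assert (I4 : tau t + 1 <= tau b).
  { pose proof (psum_ge_term (ind T) t b t (ind_nonneg T) ltac:(lia)) as G.
    unfold ind at 1 in G. rewrite Ti in G. unfold tau. lra. }
  rewrite S_INR in I2. nra.
- assert (I2 : A * (INR b - INR a) - B <= E b - E a).
  { apply free_segment_energy; [lia|]. intros j Hj. apply H; [lia|].
    destruct (T j) eqn:ET; [|reflexivity].
    exfalso. apply Hno. exists j. auto. }
  assert (tau a <= tau b) by (apply psum_mono; [apply ind_nonneg|lia]).
  nra.
Qed.

(** w >= 0 is clamped at both ends of the grid.  Where w > 0 the load of v is 1, and
    off the exceptional set T it is 1 minus the fourth difference of w, a nonnegative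
    quantity that vanishes where w > 0. *)
Variables (w : nat -> R) (m : nat).
Hypothesis Hm : (4 <= m)%nat.
Hypothesis Hw : forall j, 0 <= w j.
Hypothesis Hw0 : forall j, (j < 2)%nat -> w j = 0.
Hypothesis Hwm : forall j, (m <= S j)%nat -> w j = 0.
Hypothesis Hfree : forall j, (j < m)%nat -> 0 < w j -> diff2 v j = 1.
Hypothesis Hgood : forall j, (j < m)%nat -> T j = false ->
  diff2 v j = 1 - diff2 (diff2 w) j /\ 0 <= diff2 (diff2 w) j /\ (0 < w j -> diff2 (diff2 w) j = 0).

Lemma good_run_interior j : (j < m)%nat -> (2 <= j)%nat -> T j = false ->
  (forall i, (j - 2 <= i <= j + 2)%nat -> w i = 0) -> diff2 v j = 1.
Proof.
intros Hj H2 HT H. destruct (Hgood j Hj HT) as [-> _].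
unfold diff2. rewrite !(H _) by lia. lra.
Qed.

(** The energy from a contact index p up to m.  A contact run [p, q] is followed by
    a gap up to the next contact p'; nothing is claimed on at most four indices
    near the ends of the run.  A run of at most four indices costs one free segment,
    paid by the node in the gap; a longer run with k interior nodes costs k + 2 free
    segments, paid by these nodes and by two more nodes near its right end or in the
    gap. *)
Lemma counting_from n p : (m - p <= n)%nat -> (p <= m)%nat -> w p = 0 ->
  A * (INR m - INR p) - (B + 4 * A) * (2 + tau m - tau p) <= E m - E p.
Proof.
revert p. induction n as [n IHn] using lt_wf_ind. intros p Hn Hp Wp.
destruct (classic (exists j, (p <= j)%nat /\ 0 < w j)) as [[j0 [Hj0 Wj0]]|Hno].
- (* the contact run [p, q], then the gap up to the next contact p' *)
  destruct (least_index (fun j => 0 < w j) p j0 Hj0 Wj0) as [q1 [Hq1 [Wq1 Hrun]]].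
  assert (Hpq1 : (p < q1)%nat).
  { destruct (Nat.eq_dec p q1) as [E1|]; [subst; lra|lia]. }
  destruct q1 as [|q]; [lia|].
  assert (Hrun' : forall j, (p <= j <= q)%nat -> w j = 0).
  { intros j Hj. specialize (Hrun j ltac:(lia)). specialize (Hw j). cbv beta in Hrun. lra. }
  clear Hrun.
  assert (Hq1' : (1 <= q)%nat).
  { destruct q as [|q]; [|lia]. rewrite (Hw0 1%nat) in Wq1 by lia. lra. }
  assert (Hqm : (S q < m - 1)%nat).
  { apply Nat.lt_nge. intros G. rewrite (Hwm (S q)) in Wq1 by lia. lra. }
  destruct (least_index (fun j => w j = 0) (S q) (m - 1)) as [p' [Hp' [Wp' Hgap]]].
  { lia. } { apply Hwm. lia. }
  assert (Hqp' : (S q < p')%nat).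
  { destruct (Nat.eq_dec (S q) p') as [E1|]; [subst; lra|lia]. }
  assert (Hgap' : forall j, (q < j < p')%nat -> 0 < w j).
  { intros j Hj. specialize (Hgap j ltac:(lia)). specialize (Hw j). cbv beta in Hgap. lra. }
  clear Hgap.
  assert (IH : A * (INR m - INR p') - (B + 4 * A) * (2 + tau m - tau p') <= E m - E p').
  { apply (IHn (m - p')%nat); try lia. exact Wp'. }
  assert (Igap : A * (INR p' - INR (S q)) - B <= E p' - E (S q)).
  { apply free_segment_energy; [lia|]. intros j Hj. apply Hfree; [lia|]. apply Hgap'. lia. }
  assert (GT : forall j, (q < j < p')%nat -> diff2 (diff2 w) j <> 0 -> T j = true).
  { intros j Hj Hd. destruct (T j) eqn:ET; [reflexivity|].
    destruct (Hgood j ltac:(lia) ET) as [_ [_ H0]].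
    exfalso. apply Hd, H0, Hgap'. exact Hj. }
  destruct (gap_positive_load w q p' Hq1' Hqp' Hw (Hrun' q ltac:(lia)) Wp' Hgap')
    as [t1 [Ht1 Lt1]].
  assert (Tt1 : T t1 = true) by (apply GT; [exact Ht1|lra]).
  rewrite S_INR in Igap.
  destruct (Nat.lt_ge_cases q (p + 4)) as [Hshort|Hlong].
  + (* at most four contacts: skip them and use the gap *)
    pose proof (energy_mono p (S q) ltac:(lia)) as I1.
    pose proof (psum_ge_term (ind T) p p' t1 (ind_nonneg T) ltac:(lia)) as I2.
    unfold ind at 1 in I2. rewrite Tt1 in I2. fold (tau p) in I2. fold (tau p') in I2.
    assert (I3 : INR q <= INR p + 3).
    { replace 3 with (INR 3) by (simpl; lra). rewrite <- plus_INR. apply le_INR. lia. }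
    nra.
  + (* skip two indices at each end of the run; the nodes split its interior *)
    pose proof (energy_mono p (p + 2) ltac:(lia)) as I1.
    assert (I2 : A * (INR (q - 1) - INR (p + 2))
        - (B + 4 * A) * (1 + tau (q - 1)%nat - tau (p + 2)%nat)
        <= E (q - 1)%nat - E (p + 2)%nat).
    { apply segment_energy_with_nodes; [lia|]. intros j Hj Tj.
      apply good_run_interior; [lia|lia|exact Tj|]. intros i Hi. apply Hrun'. lia. }
    pose proof (energy_mono (q - 1) (S q) ltac:(lia)) as I3.
    assert (I4 : tau p <= tau (p + 2)%nat) by (apply psum_mono; [apply ind_nonneg|lia]).
    assert (I5 : 2 <= tau p' - tau (q - 1)%nat).
    { assert (exists t2, (q - 1 <= t2 < p')%nat /\ t2 <> t1 /\ T t2 = true)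
        as [t2 [Ht2 [Ne Tt2]]].
      { destruct (gap_negative_load w q p') as [t2 [Ht2 Lt2]]; try assumption; try lia.
        { intros i Hi. apply Hrun'. lia. }
        exists t2. split; [exact Ht2|]. split; [intros ->; lra|].
        destruct (T t2) eqn:ET; [reflexivity|].
        destruct (Hgood t2 ltac:(lia) ET) as [_ [H0 _]]. lra. }
      pose proof (psum_ge_term2 (ind T) (q - 1) p' t1 t2 (ind_nonneg T)
         ltac:(lia) ltac:(lia) ltac:(congruence)) as G.
      unfold ind at 1 2 in G. rewrite Tt1, Tt2 in G. unfold tau. lra. }
    rewrite minus_INR, plus_INR in I2 by lia. simpl (INR 1) in I2. simpl (INR 2) in I2.
    nra.
- (* contact from p on *)
  assert (Hz : forall j, (p <= j)%nat -> w j = 0).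
  { intros j Hj. specialize (Hw j).
    destruct (Rle_lt_or_eq_dec _ _ Hw) as [G|G]; [|congruence].
    exfalso. apply Hno. exists j. auto. }
  destruct (Nat.lt_ge_cases m (p + 2)) as [Hs|Hl].
  + assert (I3 : INR m <= INR p + 1).
    { replace 1 with (INR 1) by reflexivity. rewrite <- plus_INR. apply le_INR. lia. }
    pose proof (energy_mono p m ltac:(lia)).
    assert (tau p <= tau m) by (apply psum_mono; [apply ind_nonneg|lia]).
    nra.
  + pose proof (energy_mono p (p + 2) ltac:(lia)) as I1.
    assert (I2 : A * (INR m - INR (p + 2))
        - (B + 4 * A) * (1 + tau m - tau (p + 2)%nat) <= E m - E (p + 2)%nat).
    { apply segment_energy_with_nodes; [lia|]. intros j Hj Tj.
      apply good_run_interior; [lia|lia|exact Tj|]. intros i Hi. apply Hz. lia. }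
    assert (I4 : tau p <= tau (p + 2)%nat) by (apply psum_mono; [apply ind_nonneg|lia]).
    rewrite plus_INR in I2. simpl (INR 2) in I2. nra.
Qed.

Lemma counting :
  A * INR m - (B + 4 * A) * (2 + tau m) <= E m.
Proof.
pose proof (counting_from m 0 ltac:(lia) ltac:(lia) (Hw0 0%nat ltac:(lia))) as H.
change (INR 0) with 0 in H. change (tau 0%nat) with 0 in H. change (E 0%nat) with 0 in H.
lra.
Qed.

End Counting.

(** * The discrete obstacle problem *)

Section Obstacle.
Variable m : nat.
(** Indices at which the sequences may be nonzero: clamped boundary conditions at
    both ends. *)
Definition active (j : nat) : Prop := (2 <= j)%nat /\ (S j < m)%nat.
(** Clamped sequences. *)
Definition supported (g : nat -> R) : Prop := forall j, ~ active j -> g j = 0.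
(** Bilinear bending energy, the discrete int g'' h''. *)
Definition energy (g h : nat -> R) : R := psum (fun j => diff2 g j * diff2 h j) m.
(** The functional int g''^2 / 2 - int g minimized in the obstacle problem. *)
Definition cost (g : nat -> R) : R := energy g g / 2 - psum g m.

(** Summation by parts, with the discrete Wronskian as boundary term. *)
Lemma psum_wronskian a b n :
  psum (fun j => a j * diff2 b j - b j * diff2 a j) n
  = a (pred n) * b n - a n * b (pred n).
Proof.
induction n as [|n IH]; simpl; [ring|]. rewrite IH. unfold diff2. ring.
Qed.

Lemma energy_by_parts g e : supported e ->
  energy g e = psum (fun j => diff2 (diff2 g) j * e j) m.
Proof.
intros He. unfold energy.
assert (H : psum (fun j => diff2 g j * diff2 e j - e j * diff2 (diff2 g) j) m = 0).
{ rewrite psum_wronskian. rewrite (He m), (He (pred m)); [ring| |];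
  unfold active; lia. }
rewrite (psum_ext _ (fun j => diff2 (diff2 g) j * e j
   + (diff2 g j * diff2 e j - e j * diff2 (diff2 g) j))) by (intros; ring).
rewrite psum_plus, H. ring.
Qed.

Lemma energy_nonneg g : 0 <= energy g g.
Proof.
unfold energy. replace 0 with (psum (fun _ => 0) m).
- apply psum_le. intros. nra.
- induction m; simpl; lra.
Qed.

(** Discrete Poincare inequality: with two zero initial values, g is recovered from
    its second differences. *)
Lemma supported_bound g : supported g ->
  forall j, Rabs (g j) <= 4 ^ j * sqrt (energy g g).
Proof.
intros Hg. set (s := sqrt (energy g g)).
assert (Hs : 0 <= s) by apply sqrt_pos.
assert (Hd : forall j, (j < m)%nat -> Rabs (diff2 g j) <= s).
{ intros j Hj. unfold s. rewrite <- (sqrt_Rsqr (Rabs (diff2 g j))) by apply Rabs_pos.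
  apply sqrt_le_1_alt. rewrite <- Rsqr_abs.
  pose proof (psum_ge_term (fun i => diff2 g i * diff2 g i) 0 m j
     ltac:(intros; nra) ltac:(lia)) as G.
  unfold energy, Rsqr. simpl psum at 2 in G. lra. }
assert (G : forall j, Rabs (g j) <= 4 ^ j * s /\ Rabs (g (S j)) <= 4 ^ S j * s).
{ induction j as [|j [I1 I2]].
  - rewrite (Hg 0%nat), (Hg 1%nat) by (unfold active; lia). rewrite Rabs_R0. simpl. lra.
  - split; [exact I2|].
    assert (P : 0 <= 4 ^ j * s) by (apply Rmult_le_pos; [apply pow_le; lra|lra]).
    destruct (Nat.lt_ge_cases (S (S j)) m) as [L|L].
    + specialize (Hd (S j) ltac:(lia)). unfold diff2 in Hd. simpl pred in Hd.
      assert (1 <= 4 ^ j) by (apply pow_R1_Rle; lra).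
      simpl pow in *. revert Hd I1 I2 P.
      unfold Rabs; repeat destruct Rcase_abs; intros; nra.
    + rewrite (Hg (S (S j))) by (unfold active; lia). rewrite Rabs_R0. simpl. nra. }
intros j. apply G.
Qed.

Lemma psum_abs_le f n : Rabs (psum f n) <= psum (fun j => Rabs (f j)) n.
Proof.
induction n as [|n IH]; simpl; [rewrite Rabs_R0; lra|].
eapply Rle_trans; [apply Rabs_triang|]. lra.
Qed.

Lemma cost_bounded_below : exists c, forall g, supported g -> c <= cost g.
Proof.
set (C := psum (fun j => 4 ^ j) m).
exists (- C ^ 2 / 2). intros g Hg.
assert (H : psum g m <= C * sqrt (energy g g)).
{ eapply Rle_trans; [apply Rle_abs|]. eapply Rle_trans; [apply psum_abs_le|].
  unfold C. rewrite Rmult_comm, <- psum_scal. apply psum_le. intros j _.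
  rewrite Rmult_comm. apply supported_bound, Hg. }
pose proof (sqrt_sqrt _ (energy_nonneg g)). unfold cost.
pose proof (pow2_ge_0 (C - sqrt (energy g g))). nra.
Qed.

Lemma energy_combination a b g h :
  energy (fun j => a * g j + b * h j) (fun j => a * g j + b * h j)
  = a ^ 2 * energy g g + 2 * a * b * energy g h + b ^ 2 * energy h h.
Proof.
unfold energy. rewrite <- !psum_scal, <- !psum_plus.
apply psum_ext. intros. unfold diff2. ring.
Qed.

Lemma cost_combination a b g h :
  cost (fun j => a * g j + b * h j)
  = (a ^ 2 * energy g g + 2 * a * b * energy g h + b ^ 2 * energy h h) / 2
    - a * psum g m - b * psum h m.
Proof.
unfold cost. rewrite energy_combination, psum_plus, !psum_scal. ring.
Qed.

Variable k : nat -> R.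
Hypothesis k_nonneg : forall j, 0 <= k j.

(** Clamped sequences below the obstacle k. *)
Definition admissible (g : nat -> R) : Prop :=
  supported g /\ forall j, g j <= k j.

Lemma psum_lim (F : nat -> nat -> R) (Fl : nat -> R) n :
  (forall j, is_lim_seq (fun i => F i j) (Fl j)) ->
  is_lim_seq (fun i => psum (F i) n) (psum Fl n).
Proof.
intros H. induction n as [|n IH]; simpl.
- apply is_lim_seq_const.
- apply is_lim_seq_plus'; [exact IH|apply H].
Qed.

(** Existence by the direct method: a minimizing sequence is Cauchy in energy by the
    parallelogram identity, hence pointwise by [supported_bound]. *)
Lemma obstacle_minimizer :
  exists g, admissible g /\ forall h, admissible h -> cost g <= cost h.
Proof.
destruct cost_bounded_below as [c Hc].
destruct (completeness (fun x => exists g, admissible g /\ x = - cost g)) as [M [HM1 HM2]].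
{ exists (- c). intros x [g [[Hg _] ->]]. specialize (Hc g Hg). lra. }
{ exists (- cost (fun _ => 0)), (fun _ => 0). split; [|reflexivity].
  split; [intros j _; reflexivity|exact k_nonneg]. }
assert (HM : forall g, admissible g -> - M <= cost g).
{ intros g Hg. enough (- cost g <= M) by lra. apply HM1. exists g. auto. }
assert (Hseq : forall n : nat, exists g, admissible g /\ cost g <= - M + / (INR n + 1)).
{ intros n. apply NNPP. intros Hno.
  assert (0 < / (INR n + 1)) by (apply RinvN_pos).
  enough (M <= M - / (INR n + 1)) by lra.
  apply HM2. intros x [g [Hg ->]].
  apply Rnot_lt_le. intros L. apply Hno. exists g. split; [exact Hg|lra]. }
pose (G := fun n => proj1_sig (constructive_indefinite_description _ (Hseq n))).
assert (HG : forall n, admissible (G n) /\ cost (G n) <= - M + / (INR n + 1)).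
{ intros n. exact (proj2_sig (constructive_indefinite_description _ (Hseq n))). }
assert (Hdist : forall n p, energy (fun j => 1 * G n j + (-1) * G p j)
    (fun j => 1 * G n j + (-1) * G p j) <= 4 * (/ (INR n + 1) + / (INR p + 1))).
{ intros n p. rewrite energy_combination.
  destruct (HG n) as [[S1 O1] C1], (HG p) as [[S2 O2] C2].
  assert (Hmid : admissible (fun j => / 2 * G n j + / 2 * G p j)).
  { split.
    - intros j Hj. rewrite (S1 j Hj), (S2 j Hj). ring.
    - intros j. specialize (O1 j). specialize (O2 j). lra. }
  apply HM in Hmid. rewrite cost_combination in Hmid.
  unfold cost in C1, C2. lra. }
assert (Hlim : forall j, ex_finite_lim_seq (fun n => G n j)).
{ intros j. apply ex_lim_seq_cauchy_corr. intros eps.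
  assert (H4 : 0 < 4 ^ j) by (apply pow_lt; lra).
  assert (He : 0 < eps / (4 ^ j)) by (apply Rdiv_lt_0_compat; [apply cond_pos|exact H4]).
  destruct (archimed_cor1 ((eps / 4 ^ j) ^ 2 / 8)) as [N0 [HN0 HN1]].
  { apply Rdiv_lt_0_compat; [apply pow_lt; exact He|lra]. }
  exists N0. intros n p Hn Hp.
  replace (G n j - G p j) with (1 * G n j + (-1) * G p j) by ring.
  assert (Sd : supported (fun j => 1 * G n j + (-1) * G p j)).
  { destruct (HG n) as [[S1 _] _], (HG p) as [[S2 _] _].
    intros i Hi. rewrite (S1 i Hi), (S2 i Hi). ring. }
  eapply Rle_lt_trans; [apply (supported_bound _ Sd j)|].
  specialize (Hdist n p).
  set (D := energy _ _) in *.
  assert (HD : D < (eps / 4 ^ j) ^ 2).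
  { assert (HI : forall q, (N0 <= q)%nat -> / (INR q + 1) < / INR N0).
    { intros q Hq. apply le_INR in Hq. apply lt_INR in HN1. simpl in HN1.
      apply Rinv_lt_contravar; [|lra]. apply Rmult_lt_0_compat; lra. }
    pose proof (HI n Hn). pose proof (HI p Hp). lra. }
  assert (sqrt D < eps / 4 ^ j).
  { rewrite <- (sqrt_pow2 (eps / 4 ^ j)) by lra. apply sqrt_lt_1_alt.
    split; [apply energy_nonneg|exact HD]. }
  replace (pos eps) with (4 ^ j * (eps / 4 ^ j)) by (field; lra).
  apply Rmult_lt_compat_l; assumption. }
pose (gl := fun j => real (Lim_seq (fun n => G n j))).
assert (Hgl : forall j, is_lim_seq (fun n => G n j) (gl j)).
{ intros j. apply Lim_seq_correct'. apply Hlim. }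
exists gl. split; [split|].
- intros j Hj. unfold gl.
  rewrite (Lim_seq_ext _ (fun _ => 0)).
  + rewrite Lim_seq_const. reflexivity.
  + intros n. apply (proj1 (HG n)). exact Hj.
- intros j. apply (is_lim_seq_le (fun n => G n j) (fun _ => k j) (gl j) (k j)).
  + intros n. apply (proj1 (HG n)).
  + apply Hgl.
  + apply is_lim_seq_const.
- intros h Hh. apply Rle_trans with (- M); [|apply HM; exact Hh].
  assert (L1 : is_lim_seq (fun n => cost (G n)) (cost gl)).
  { unfold cost, energy, Rdiv.
    apply is_lim_seq_minus'; [|apply psum_lim; exact Hgl].
    apply is_lim_seq_mult'; [|apply is_lim_seq_const].
    assert (Ld : forall j, is_lim_seq (fun n => diff2 (G n) j) (diff2 gl j)).
    { intros j. unfold diff2. apply is_lim_seq_plus'; [|apply Hgl].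
      apply is_lim_seq_minus'; [apply Hgl|].
      apply is_lim_seq_mult'; [apply is_lim_seq_const|apply Hgl]. }
    apply (psum_lim (fun n j => diff2 (G n) j * diff2 (G n) j)).
    intros j. apply is_lim_seq_mult'; apply Ld. }
  assert (L2 : is_lim_seq (fun n => - M + / (INR n + 1)) (- M)).
  { replace (Finite (- M)) with (Finite (- M + 0)) by (f_equal; ring).
    apply is_lim_seq_plus'; [apply is_lim_seq_const|].
    apply (is_lim_seq_ext (fun n => / INR (n + 1))).
    { intros n. rewrite plus_INR. reflexivity. }
    apply (is_lim_seq_incr_n (fun n => / INR n) 1 0).
    apply (is_lim_seq_inv INR p_infty); [apply is_lim_seq_INR|discriminate]. }
  apply (is_lim_seq_le (fun n => cost (G n)) (fun n => - M + / (INR n + 1)) (cost gl) (- M));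
    [apply HG|exact L1|exact L2].
Qed.

(** The unit sequence at j. *)
Definition unit_at (j i : nat) : R := if Nat.eq_dec i j then 1 else 0.

Lemma psum_unit f j n : (j < n)%nat -> psum (fun i => f i * unit_at j i) n = f j.
Proof.
assert (Z : forall n, (n <= j)%nat -> psum (fun i => f i * unit_at j i) n = 0).
{ induction n0 as [|n0 IH]; intros H; simpl; [reflexivity|].
  rewrite IH by lia. unfold unit_at. destruct Nat.eq_dec; [lia|ring]. }
induction n as [|n IH]; intros H; [lia|]. simpl.
destruct (Nat.eq_dec n j) as [->|Ne].
- rewrite Z by lia. unfold unit_at. destruct Nat.eq_dec; [ring|lia].
- rewrite IH by lia. unfold unit_at. destruct Nat.eq_dec; [lia|ring].
Qed.

(** The Euler-Lagrange conditions: the fourth difference of g is 1 - nu with nu >= 0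
    supported on the contact set. *)
Lemma obstacle_problem :
  exists g nu : nat -> R, supported g /\ (forall j, g j <= k j) /\
    forall j, active j ->
      diff2 (diff2 g) j = 1 - nu j /\ 0 <= nu j /\ (g j < k j -> nu j = 0).
Proof.
destruct obstacle_minimizer as [g [[Sg Og] Hmin]].
exists g, (fun j => 1 - diff2 (diff2 g) j).
split; [exact Sg|]. split; [exact Og|].
intros j Hj.
assert (Su : supported (unit_at j)).
{ intros i Hi. unfold unit_at. destruct Nat.eq_dec; [subst; contradiction|reflexivity]. }
assert (Hjm : (j < m)%nat) by (unfold active in Hj; lia).
set (K := energy (unit_at j) (unit_at j)).
assert (HK : 0 <= K) by apply energy_nonneg.
assert (Hvar : forall s, s <= k j - g j ->
          0 <= s * (diff2 (diff2 g) j - 1) + s ^ 2 * K / 2).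
{ intros s Hs.
  assert (Ad : admissible (fun i => 1 * g i + s * unit_at j i)).
  { split.
    - intros i Hi. rewrite (Sg i Hi), (Su i Hi). ring.
    - intros i. unfold unit_at. destruct Nat.eq_dec; [subst; lra|].
      specialize (Og i). lra. }
  apply Hmin in Ad. rewrite cost_combination in Ad.
  rewrite (energy_by_parts g _ Su), psum_unit in Ad by exact Hjm.
  assert (Pu : psum (unit_at j) m = 1).
  { rewrite <- (psum_unit (fun _ => 1) j m Hjm). apply psum_ext. intros; ring. }
  rewrite Pu in Ad. fold K in Ad. unfold cost in Ad. lra. }
set (d := diff2 (diff2 g) j) in *.
specialize (Og j).
(* a small step s gives the sign of the first variation *)
assert (Hneg : d <= 1).
{ apply Rnot_lt_le. intros L.
  assert (Hp : 0 < K + 1) by lra.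
  assert (E : (d - 1) / (K + 1) * (K + 1) = d - 1) by (field; lra).
  set (s := (d - 1) / (K + 1)) in *.
  assert (0 < s) by (unfold s; apply Rdiv_lt_0_compat; lra).
  specialize (Hvar (- s) ltac:(lra)). rewrite <- E in Hvar.
  assert (0 < s * s) by nra. nra. }
split; [ring|]. split; [lra|].
intros L. enough (1 <= d) by lra.
apply Rnot_lt_le. intros L2.
set (s := Rmin (k j - g j) ((1 - d) / (K + 1))).
assert (E : (1 - d) / (K + 1) * (K + 1) = 1 - d) by (field; lra).
assert (0 < (1 - d) / (K + 1)) by (apply Rdiv_lt_0_compat; lra).
assert (0 < s) by (apply Rmin_glb_lt; lra).
assert (s <= (1 - d) / (K + 1)) by apply Rmin_r.
specialize (Hvar s (Rmin_l _ _)).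
assert (0 < s * s) by nra.
assert (s * (K + 1) <= 1 - d).
{ rewrite <- E. apply Rmult_le_compat_r; lra. }
assert (s * (s * (K + 1)) <= s * (1 - d)) by (apply Rmult_le_compat_l; lra). nra.
Qed.

End Obstacle.

(** * Energy bound for a discrete kernel *)

Lemma diff2_minus f g j : diff2 (fun i => f i - g i) j = diff2 f j - diff2 g j.
Proof. unfold diff2. ring. Qed.

Lemma diff2_ext f g j : (forall i, f i = g i) -> diff2 f j = diff2 g j.
Proof. intros H. unfold diff2. rewrite !H. reflexivity. Qed.

(** A nonnegative clamped sequence k whose fourth difference is 1 off a set T of
    indices has a large sum if T is small.  The numbers H^4/144 and
    H^4/72 + H^5/180 come from [segment_energy_linear]; H is the slope parameter of
    the tangent and will be the average length of a segment. *)
Lemma discrete_kernel_bound m k T H :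
  (4 <= m)%nat -> 0 <= H -> (forall j, 0 <= k j) -> supported m k ->
  (forall j, (j < m)%nat -> T j = false -> active m j /\ diff2 (diff2 k) j = 1) ->
  H ^ 4 / 144 * INR m
   - (H ^ 4 / 72 + H ^ 5 / 180 + 4 * (H ^ 4 / 144)) * (2 + psum (ind T) m)
  <= psum k m.
Proof.
intros Hm HH Hk Sk HT.
destruct (obstacle_problem m k Hk) as [g [nu [Sg [Og HO]]]].
assert (H4 : 0 <= H ^ 4) by (apply pow_le; lra).
assert (H5 : 0 <= H ^ 5) by (apply pow_le; lra).
apply Rle_trans with (psum (fun j => diff2 g j ^ 2) m).
- assert (Hact : forall j, 0 < k j - g j -> active m j).
  { intros j L. apply NNPP. intros Na. rewrite (Sk j Na), (Sg j Na) in L. lra. }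
  apply counting with (w := fun j => k j - g j); try lra; try assumption.
  + intros a n. apply segment_energy_linear. exact HH.
  + intros j. specialize (Og j). lra.
  + intros j Hj. rewrite Sk, Sg by (unfold active; lia). ring.
  + intros j Hj. rewrite Sk, Sg by (unfold active; lia). ring.
  + intros j _ L. destruct (HO j (Hact j L)) as [-> [_ ->]]; lra.
  + intros j Hj Tj. destruct (HT j Hj Tj) as [Aj Kj].
    destruct (HO j Aj) as [G1 [G2 G3]].
    rewrite (diff2_ext _ _ j (diff2_minus k g)), diff2_minus, Kj, G1.
    split; [ring|]. split; [lra|]. intros L. rewrite G3 by lra. ring.
- rewrite (psum_ext _ (fun j => diff2 g j * diff2 g j)) by (intros; ring).
  change (energy m g g <= psum k m). rewrite (energy_by_parts m g g Sg).
  apply psum_le. intros j _.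
  destruct (classic (active m j)) as [Aj|Na].
  + destruct (HO j Aj) as [-> [G2 G3]]. specialize (Og j). specialize (Hk j).
    destruct (Rle_lt_or_eq_dec _ _ Og) as [L|E]; [rewrite G3 by exact L; lra|].
    rewrite E. nra.
  + rewrite (Sg j Na), (Sk j Na). lra.
Qed.

(** Whether j is one of t 0, ..., t (n - 1). *)
Fixpoint hits (t : nat -> nat) (n j : nat) : bool :=
  match n with O => false | S i => hits t i j || (t i =? j)%nat end.

Lemma psum_ind_hits t n m : psum (ind (hits t n)) m <= INR n.
Proof.
induction n as [|n IH].
- simpl. unfold ind. simpl. induction m; simpl; lra.
- apply Rle_trans with (psum (ind (hits t n)) m + psum (unit_at (t n)) m).
  + rewrite <- psum_plus. apply psum_le. intros j _. unfold ind, unit_at. simpl hits.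
    destruct (hits t n j), (Nat.eqb_spec (t n) j), Nat.eq_dec; simpl; try lra.
    exfalso. congruence.
  + assert (psum (unit_at (t n)) m <= 1).
    { rewrite (psum_ext _ (fun i => 1 * unit_at (t n) i)) by (intros; ring).
      destruct (Nat.lt_ge_cases (t n) m) as [L|L].
      - rewrite psum_unit by exact L. lra.
      - rewrite (psum_ext _ (fun _ => 0)).
        2:{ intros j Hj. unfold unit_at. destruct Nat.eq_dec; [lia|]. simpl. ring. }
        clear. induction m; simpl; lra. }
    rewrite S_INR. lra.
Qed.

(** Discrete analogue of x_+^3/6: the fourth difference of j |-> tcubic (t - j) is the
    unit at t.  Truncated subtraction of natural numbers does the
    truncation, because tcubic 0 = 0. *)
Definition tcubic (l : nat) : R := (INR l ^ 3 - INR l) / 6.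
(** Sum of tcubic over 0, ..., l. *)
Definition tquartic (l : nat) : R :=
  (INR l - 1) * INR l * (INR l + 1) * (INR l + 2) / 24.

Lemma diff4_tcubic t j : (2 <= j)%nat -> t <> j ->
  diff2 (diff2 (fun i => tcubic (t - i))) j = 0.
Proof.
intros Hj Ht. unfold diff2. destruct j as [|[|j]]; try lia. simpl pred.
destruct (Nat.lt_ge_cases t (S (S j))) as [L|L].
- destruct (Nat.eq_dec t (S j)) as [->|].
  + replace (S j - j)%nat with 1%nat by lia.
    rewrite !(proj2 (Nat.sub_0_le (S j) _)) by lia. unfold tcubic. simpl. field.
  + rewrite !(proj2 (Nat.sub_0_le t _)) by lia. unfold tcubic. simpl. field.
- destruct (Nat.eq_dec t (S (S (S j)))) as [->|].
  + replace (S (S (S j)) - j)%nat with 3%nat by lia.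
    replace (S (S (S j)) - S j)%nat with 2%nat by lia.
    replace (S (S (S j)) - S (S j))%nat with 1%nat by lia.
    rewrite !(proj2 (Nat.sub_0_le (S (S (S j))) _)) by lia. unfold tcubic. simpl. field.
  + unfold tcubic. rewrite !minus_INR by lia. rewrite !S_INR. field.
Qed.

Lemma psum_tcubic t n : psum (fun j => tcubic (t - j)) n = tquartic t - tquartic (t - n).
Proof.
induction n as [|n IH]; cbn [psum].
- rewrite Nat.sub_0_r. ring.
- rewrite IH. destruct (Nat.lt_ge_cases n t) as [L|L].
  + replace (t - n)%nat with (S (t - S n)) by lia. unfold tcubic, tquartic.
    rewrite !S_INR. field.
  + rewrite !(proj2 (Nat.sub_0_le t _)) by lia. unfold tcubic, tquartic. simpl. field.
Qed.

Lemma psum_quartic m n : (n <= m)%nat ->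
  let G x := x * (x + 1) * (2 * x + 1) * (3 * x ^ 2 + 3 * x - 1) / 30 in
  psum (fun j => (INR m - INR j) ^ 4) n = G (INR m) - G (INR m - INR n).
Proof.
intros H G. induction n as [|n IH]; cbn [psum].
- simpl. unfold G. field.
- rewrite IH by lia. rewrite S_INR. unfold G. field.
Qed.

(** * Test functions *)

Lemma D_in_of_is_derive f g D x : is_derive f x (g x) -> D_in f g D x.
Proof.
intros H. apply is_derive_Reals in H.
apply derivable_pt_lim_D_in in H. unfold D_in in *.
intros eps He. destruct (H eps He) as [al [Ha1 Ha2]]. exists al. split; [exact Ha1|].
intros y [[Hy1 Hy2] Hy3]. apply Ha2. unfold D_x, no_cond. auto.
Qed.

Lemma C4_with_of_is_derive f f1 f2 f3 f4 :
  (forall x, is_derive f x (f1 x)) -> (forall x, is_derive f1 x (f2 x)) ->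
  (forall x, is_derive f2 x (f3 x)) -> (forall x, is_derive f3 x (f4 x)) ->
  (forall x, continuous f4 x) -> C4_with f f4.
Proof.
intros H1 H2 H3 H4 Hc. exists f1, f2, f3. intros x _.
repeat split; try (apply D_in_of_is_derive; auto).
specialize (Hc x). apply continuity_pt_filterlim in Hc.
intros eps He. destruct (Hc eps He) as [al [Ha1 Ha2]]. exists al. split; [exact Ha1|].
intros y [[Hy1 Hy2] Hy3]. apply Ha2. unfold D_x, no_cond. auto.
Qed.

(** Truncated power y_+^n, for n >= 1. *)
Definition tp (n : nat) (y : R) : R := Rmax 0 y ^ n.

Lemma tp_pos n y : 0 <= y -> tp n y = y ^ n.
Proof. intros H. unfold tp. rewrite Rmax_right by exact H. reflexivity. Qed.

Lemma tp_neg n y : y <= 0 -> tp (S n) y = 0.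
Proof. intros H. unfold tp. rewrite Rmax_left by exact H. simpl. ring. Qed.

Lemma is_derive_tp n y : is_derive (tp (S (S n))) y (INR (S (S n)) * tp (S n) y).
Proof.
destruct (Rtotal_order y 0) as [L|[E|L]].
- rewrite tp_neg, Rmult_0_r by lra.
  apply is_derive_ext_loc with (fun _ => 0); [|exact (is_derive_const (V := R_NormedModule) 0 y)].
  assert (P : 0 < - y) by lra. exists (mkposreal _ P). intros z Hz.
  unfold ball in Hz; simpl in Hz; unfold AbsRing_ball, abs, minus, plus, opp in Hz; simpl in Hz.
  symmetry. apply tp_neg. revert Hz. unfold Rabs. destruct Rcase_abs; lra.
- subst y. rewrite tp_neg, Rmult_0_r by lra. apply is_derive_Reals.
  intros eps He. assert (P : 0 < Rmin 1 eps) by (apply Rmin_glb_lt; lra).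
  exists (mkposreal _ P). intros h Hh Hl. simpl in Hl.
  rewrite Rplus_0_l, (tp_neg (S n) 0) by lra. unfold Rminus. rewrite Ropp_0, !Rplus_0_r.
  pose proof (Rmin_l 1 eps). pose proof (Rmin_r 1 eps).
  destruct (Rle_lt_dec h 0) as [L|L].
  + rewrite tp_neg by exact L. unfold Rdiv. rewrite Rmult_0_l, Rabs_R0. exact He.
  + rewrite tp_pos by lra. replace (h ^ S (S n) / h) with (h * h ^ n) by (simpl; field; lra).
    rewrite Rabs_pos_eq in Hl by lra.
    assert (0 <= h ^ n <= 1).
    { split; [apply pow_le; lra|]. rewrite <- (pow1 n). apply pow_incr. lra. }
    rewrite Rabs_pos_eq by (apply Rmult_le_pos; lra). nra.
- rewrite tp_pos by lra.
  apply is_derive_ext_loc with (fun z => z ^ S (S n)).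
  + exists (mkposreal _ L). intros z Hz.
    unfold ball in Hz; simpl in Hz; unfold AbsRing_ball, abs, minus, plus, opp in Hz; simpl in Hz.
    symmetry. apply tp_pos. revert Hz. unfold Rabs. destruct Rcase_abs; lra.
  + apply is_derive_Reals. apply (derivable_pt_lim_pow y (S (S n))).
Qed.

(** Second difference of the truncated power; tpd 5 / 120 is a C^4 function close to
    y_+^3/6 whose fourth derivative is the hat function tpd 1. *)
Definition tpd (n : nat) (y : R) : R := tp n (y + 1) - 2 * tp n y + tp n (y - 1).

Lemma is_derive_tp_affine n a b y :
  is_derive (fun x => tp (S (S n)) (a * x + b)) y (a * (INR (S (S n)) * tp (S n) (a * y + b))).
Proof.
apply (is_derive_comp (tp (S (S n))) (fun x => a * x + b)).
- apply is_derive_tp.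
- auto_derive; [exact I|ring].
Qed.

Lemma is_derive_tpd n a b y :
  is_derive (fun x => tpd (S (S n)) (a * x - b)) y (INR (S (S n)) * (a * tpd (S n) (a * y - b))).
Proof.
apply (is_derive_ext (fun x => tp (S (S n)) (a * x + (- b + 1))
   - 2 * tp (S (S n)) (a * x + - b) + tp (S (S n)) (a * x + (- b - 1)))).
{ intros x. unfold tpd, Rminus. rewrite !Rplus_assoc. reflexivity. }
replace (INR (S (S n)) * (a * tpd (S n) (a * y - b))) with
 (a * (INR (S (S n)) * tp (S n) (a * y + (- b + 1)))
  - 2 * (a * (INR (S (S n)) * tp (S n) (a * y + - b)))
  + a * (INR (S (S n)) * tp (S n) (a * y + (- b - 1)))).
2:{ unfold tpd. replace (a * y - b + 1) with (a * y + (- b + 1)) by ring.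
    replace (a * y - b - 1) with (a * y + (- b - 1)) by ring.
    replace (a * y - b) with (a * y + - b) by ring. ring. }
apply @is_derive_plus; [apply @is_derive_minus|]; try apply is_derive_tp_affine.
apply is_derive_scal, is_derive_tp_affine.
Qed.

Lemma continuous_tpd1 a b y : continuous (fun x => tpd 1 (a * x - b)) y.
Proof.
assert (H : forall d, continuous (fun x => tp 1 (a * x - b + d)) y).
{ intros d. apply (continuous_ext (fun x => Rmax 0 (a * x - b + d))).
  { intros x. unfold tp. simpl. ring. }
  apply (continuous_ext (fun x => (0 + (a * x - b + d) + Rabs (0 - (a * x - b + d))) / 2)).
  { intros x. unfold Rmax, Rabs. destruct Rle_dec, Rcase_abs; lra. }
  apply continuity_pt_filterlim. reg. }
unfold tpd.
apply (continuous_plus (V := R_NormedModule)); [apply (continuous_minus (V := R_NormedModule))|].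
- apply H.
- apply (continuous_scal_r 2 (V := R_NormedModule)).
  apply (continuous_ext (fun x => tp 1 (a * x - b + 0))); [|apply H].
  intros x. rewrite Rplus_0_r. reflexivity.
- apply H.
Qed.

Lemma tpd1_nonneg y : 0 <= tpd 1 y.
Proof. unfold tpd, tp. simpl. unfold Rmax. repeat destruct Rle_dec; lra. Qed.

Lemma is_derive_scaled (c : R) (f g : R -> R) (x l l' : R) :
  is_derive f x l -> (forall t : R, g t = c * f t) -> l' = c * l -> is_derive g x l'.
Proof.
intros H Hg ->. apply (is_derive_ext (fun t => c * f t)).
- intros t. symmetry. apply Hg.
- apply is_derive_scal, H.
Qed.

Lemma C4_with_bump a b : C4_with (fun x => tpd 5 (a * x - b) / 120)
  (fun x => a ^ 4 * tpd 1 (a * x - b)).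
Proof.
apply (C4_with_of_is_derive _ (fun x => a * tpd 4 (a * x - b) / 24)
  (fun x => a ^ 2 * tpd 3 (a * x - b) / 6) (fun x => a ^ 3 * tpd 2 (a * x - b) / 2)).
- intros x. apply (is_derive_scaled (/ 120) _ _ x _ _ (is_derive_tpd 3 a b x));
    [intros t; unfold Rdiv; ring|simpl INR; field].
- intros x. apply (is_derive_scaled (a / 24) _ _ x _ _ (is_derive_tpd 2 a b x));
    [intros t; unfold Rdiv; ring|simpl INR; field].
- intros x. apply (is_derive_scaled (a ^ 2 / 6) _ _ x _ _ (is_derive_tpd 1 a b x));
    [intros t; unfold Rdiv; ring|simpl INR; field].
- intros x. apply (is_derive_scaled (a ^ 3 / 2) _ _ x _ _ (is_derive_tpd 0 a b x));
    [intros t; unfold Rdiv; ring|simpl INR; field].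
- intros x. apply (continuous_scal_r (a ^ 4) (V := R_NormedModule)), continuous_tpd1.
Qed.

Lemma RInt_bump a b : a <> 0 ->
  RInt (fun x => tpd 5 (a * x - b) / 120) 0 1
  = (tpd 6 (a - b) - tpd 6 (- b)) / (720 * a).
Proof.
intros Ha. apply is_RInt_unique.
replace ((tpd 6 (a - b) - tpd 6 (- b)) / (720 * a)) with
  (minus (/ (720 * a) * tpd 6 (a * 1 - b)) (/ (720 * a) * tpd 6 (a * 0 - b))).
2:{ unfold minus, plus, opp; simpl. rewrite Rmult_1_r, Rmult_0_r.
    replace (0 - b) with (- b) by ring. field. exact Ha. }
apply (is_RInt_derive (fun x => / (720 * a) * tpd 6 (a * x - b))).
- intros x _.
  apply (is_derive_scaled (/ (720 * a)) _ _ x _ _ (is_derive_tpd 4 a b x));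
    [intros t; reflexivity|simpl INR; field; exact Ha].
- intros x _. apply (ex_derive_continuous (V := R_NormedModule)).
  eexists. apply (is_derive_scaled (/ 120) _ _ x _ _ (is_derive_tpd 3 a b x));
    [intros t; unfold Rdiv; ring|reflexivity].
Qed.

Lemma C4_with_monomial : C4_with (fun x => x ^ 4 / 24) (fun _ => 1).
Proof.
apply (C4_with_of_is_derive _ (fun x => x ^ 3 / 6) (fun x => x ^ 2 / 2) (fun x => x));
  intros x; try (auto_derive; [exact I|field]). apply continuous_const.
Qed.

Lemma RInt_monomial : RInt (fun x => x ^ 4 / 24) 0 1 = 1 / 120.
Proof.
apply is_RInt_unique.
replace (1 / 120) with (minus (1 ^ 5 / 120) (0 ^ 5 / 120))
  by (unfold minus, plus, opp; simpl; field).
apply (is_RInt_derive (fun x => x ^ 5 / 120)).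
- intros x _. auto_derive; [exact I|field].
- intros x _. apply (ex_derive_continuous (V := R_NormedModule)). auto_derive. exact I.
Qed.

(** The error constant is the remainder of x^4/24, hence unique. *)
Lemma positive_definite4_value Q c :
  positive_definite4_with Q c -> c = remainder Q (fun x => x ^ 4 / 24).
Proof.
intros [_ H]. destruct (H _ _ C4_with_monomial) as [xi [_ ->]]. ring.
Qed.

Lemma c4_unique Q c : positive_definite4_with Q c -> c4 Q = c.
Proof.
intros H. unfold c4. apply (iota_unique (V := R_CompleteNormedModule)); [|exact H].
intros y Hy. rewrite (positive_definite4_value _ _ H). apply positive_definite4_value, Hy.
Qed.

Lemma sum_n_m_psum (u : nat -> R) n : sum_n_m u 1 n = psum (fun i => u (S i)) n.
Proof.
induction n as [|n IH].
- rewrite sum_n_m_zero by lia. reflexivity.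
- rewrite sum_n_Sm by lia. rewrite IH. reflexivity.
Qed.

(** * Lower bound for the error constant *)

Lemma tp_nonneg n y : 0 <= tp n y.
Proof. apply pow_le, Rmax_l. Qed.

(** Rounding the node z down to t, and passing from the smooth to the discrete
    truncated cubic, costs O(m^2) where the cubic itself is O(m^3). *)
Lemma bump_tcubic_close m t j z :
  2 <= INR m -> (t <= m)%nat -> INR t <= z < INR t + 1 ->
  Rabs (tpd 5 (z - INR j) / 120 - tcubic (t - j)) <= 2 * INR m ^ 2.
Proof.
intros Hm Ht Hz. apply Rabs_le. unfold tpd.
assert (Hm2 : 4 <= INR m ^ 2) by nra.
destruct (Nat.lt_ge_cases t j) as [L|L].
- rewrite (proj2 (Nat.sub_0_le t j)) by lia.
  assert (INR t + 1 <= INR j) by (rewrite <- S_INR; apply le_INR; lia).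
  rewrite (tp_neg 4 (z - INR j)), (tp_neg 4 (z - INR j - 1)) by lra.
  pose proof (tp_nonneg 5 (z - INR j + 1)).
  assert (tp 5 (z - INR j + 1) <= 1).
  { unfold tp. rewrite <- (pow1 5). apply pow_incr. split; [apply Rmax_l|].
    apply Rmax_lub; lra. }
  unfold tcubic. simpl INR. lra.
- replace z with (z - INR t + INR t) by ring.
  set (u := z - INR t). assert (Hu : 0 <= u < 1) by (unfold u; lra).
  replace (u + INR t - INR j) with (u + INR (t - j)) by (rewrite minus_INR by lia; ring).
  assert (Hl : INR (t - j) <= INR m) by (apply le_INR; lia).
  unfold tcubic. destruct (t - j)%nat as [|l'] eqn:El.
  + simpl INR. rewrite Rplus_0_r.
    rewrite (tp_neg 4 (u - 1)), (tp_pos 5 u), (tp_pos 5 (u + 1)) by lra.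
    assert (0 <= u ^ 5 <= 1) by (split; [apply pow_le; lra|rewrite <- (pow1 5); apply pow_incr; lra]).
    assert (0 <= (u + 1) ^ 5 <= 2 ^ 5) by (split; [apply pow_le; lra|apply pow_incr; lra]).
    lra.
  + assert (Hl1 : 1 <= INR (S l')) by (rewrite S_INR; pose proof (pos_INR l'); lra).
    set (l := INR (S l')) in *. rewrite !tp_pos by lra.
    replace (((u + l + 1) ^ 5 - 2 * (u + l) ^ 5 + (u + l - 1) ^ 5) / 120 - (l ^ 3 - l) / 6)
      with (u * (3 * l ^ 2 + 3 * l * u + u ^ 2) / 6 + (u + l) / 12 + l / 6) by field.
    assert (l ^ 2 <= INR m ^ 2) by (apply pow_incr; lra).
    assert (Hb : 0 <= 3 * l ^ 2 + 3 * l * u + u ^ 2 <= 3 * l ^ 2 + 3 * l + 1) by nra.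
    assert (0 <= u * (3 * l ^ 2 + 3 * l * u + u ^ 2) <= 3 * l ^ 2 + 3 * l + 1) by nra.
    assert (l <= l ^ 2) by nra. lra.
Qed.

Lemma tquartic_close M t z :
  2 <= M -> INR t <= M -> INR t <= z < INR t + 1 ->
  Rabs (z ^ 4 / 24 - tquartic t) <= M ^ 3.
Proof.
intros HM Ht Hz. unfold tquartic. pose proof (pos_INR t).
set (x := INR t) in *. apply Rabs_le.
assert (x ^ 4 <= z ^ 4 <= (x + 1) ^ 4) by (split; apply pow_incr; lra).
assert (E1 : 0 <= x ^ 2 <= M ^ 2) by (split; [apply pow_le; lra|apply pow_incr; lra]).
assert (E2 : 0 <= x ^ 3 <= M ^ 3) by (split; [apply pow_le; lra|apply pow_incr; lra]).
assert (2 * M <= M ^ 2) by nra. assert (2 * M ^ 2 <= M ^ 3) by nra.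
replace ((x - 1) * x * (x + 1) * (x + 2)) with (x ^ 4 + 2 * x ^ 3 - x ^ 2 - 2 * x) by ring.
replace ((x + 1) ^ 4) with (x ^ 4 + 4 * x ^ 3 + 6 * x ^ 2 + 4 * x + 1) in * by ring.
lra.
Qed.

Lemma psum_swap f n p :
  psum (fun j => psum (fun i => f i j) n) p = psum (fun i => psum (fun j => f i j) p) n.
Proof.
induction p as [|p IH]; simpl.
- induction n; simpl; lra.
- rewrite IH, <- psum_plus. reflexivity.
Qed.

Lemma psum_abs_close a x y d n :
  (forall i, (i < n)%nat -> Rabs (x i - y i) <= d) ->
  Rabs (psum (fun i => a i * x i) n - psum (fun i => a i * y i) n)
  <= psum (fun i => Rabs (a i)) n * d.
Proof.
intros H. induction n as [|n IH]; cbn [psum].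
- rewrite Rminus_0_r, Rabs_R0. lra.
- replace (_ + _ - _) with ((psum (fun i => a i * x i) n - psum (fun i => a i * y i) n)
    + a n * (x n - y n)) by ring.
  eapply Rle_trans; [apply Rabs_triang|]. rewrite Rabs_mult.
  specialize (IH ltac:(intros; apply H; lia)). specialize (H n ltac:(lia)).
  pose proof (Rabs_pos (a n)). nra.
Qed.

Lemma hits_false t n j : hits t n j = false -> forall i, (i < n)%nat -> t i <> j.
Proof.
induction n as [|n IH]; intros H i Hi; [lia|]. simpl in H.
apply orb_false_elim in H. destruct H as [H1 H2]. apply Nat.eqb_neq in H2.
destruct (Nat.eq_dec i n) as [->|]; [exact H2|]. apply IH; [exact H1|lia].
Qed.

Lemma diff4_quartic M j : (2 <= j)%nat ->
  diff2 (diff2 (fun i => (M - INR i) ^ 4 / 24)) j = 1.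
Proof.
intros Hj. destruct j as [|[|j]]; try lia. unfold diff2. simpl pred. rewrite !S_INR. field.
Qed.

Lemma diff4_psum_tcubic a t n j : (2 <= j)%nat -> (forall i, (i < n)%nat -> t i <> j) ->
  diff2 (diff2 (fun l => psum (fun i => a i * tcubic (t i - l)) n)) j = 0.
Proof.
intros Hj. induction n as [|n IH]; intros H.
- unfold diff2. simpl. ring.
- transitivity (diff2 (diff2 (fun l => psum (fun i => a i * tcubic (t i - l)) n)) j
    + a n * diff2 (diff2 (fun l => tcubic (t n - l))) j).
  + unfold diff2. cbn [psum]. ring.
  + rewrite IH by (intros; apply H; lia). rewrite diff4_tcubic; [ring|exact Hj|]. apply H. lia.
Qed.

(** The seven exceptional indices near the ends of the grid, followed by those of t. *)
Definition boundary_or (m : nat) (t : nat -> nat) (i : nat) : nat :=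
  match i with
  | 0 => 0 | 1 => 1 | 2 => 2 | 3 => 3 | 4 => m - 3 | 5 => m - 2 | 6 => m - 1
  | S (S (S (S (S (S (S i)))))) => t i
  end%nat.

Section LowerBound.
Variables (N : nat) (Q : (R -> R) -> R) (c : R) (a tau : nat -> R).
Hypothesis Htau : forall i, (i < N)%nat -> 0 <= tau i <= 1.
Hypothesis HQ : forall f : R -> R, Q f = psum (fun i => a i * f (tau i)) N.
Hypothesis Hc : positive_definite4_with Q c.

Let S1 := psum (fun i => Rabs (a i)) N.

Lemma S1_nonneg : 0 <= S1.
Proof. apply (psum_mono _ 0 N); [intros; apply Rabs_pos|lia]. Qed.

(** The bound on the grid of mesh 1/m.  The kernel is
    K(t) = (1-t)^4/24 - sum a_i (tau_i - t)_+^3/6, the sequence k1 is m^4 K(j/m) with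
    rounded nodes, raised by O(m^3) to make it nonnegative. *)
Lemma grid_kernel_bound m : (8 <= m)%nat ->
  1 / (720 * (INR N + 9) ^ 4) * INR m ^ 5 - INR m ^ 4 / (24 * (INR N + 9) ^ 3)
  <= INR m ^ 5 * c + (3 * S1 + 2) * INR m ^ 4.
Proof.
intros Hm. set (M := INR m).
assert (HM : 8 <= M) by (replace 8 with (INR 8) by (simpl; ring); apply le_INR, Hm).
pose proof S1_nonneg as HS1.
assert (Hfl : forall i, { t : nat | (i < N)%nat -> INR t <= M * tau i < INR t + 1 }).
{ intros i. destruct (nfloor_ex (Rmax 0 (M * tau i)) (Rmax_l _ _)) as [t Ht].
  exists t. intros Hi. specialize (Htau i Hi). rewrite Rmax_right in Ht; [exact Ht|nra]. }
pose (t := fun i => proj1_sig (Hfl i)).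
assert (Ht : forall i, (i < N)%nat -> INR (t i) <= M * tau i < INR (t i) + 1).
{ intros i. exact (proj2_sig (Hfl i)). }
assert (Htm : forall i, (i < N)%nat -> (t i <= m)%nat).
{ intros i Hi. apply INR_le. specialize (Ht i Hi). specialize (Htau i Hi). fold M. nra. }
set (k1 := fun j => (M - INR j) ^ 4 / 24
   - M * psum (fun i => a i * tcubic (t i - j)) N + (2 * S1 + 1) * M ^ 3).
assert (Hk1 : forall j, (j < m)%nat -> 0 <= k1 j).
{ intros j Hj.
  destruct Hc as [Hc0 Hpd].
  destruct (Hpd _ _ (C4_with_bump M (INR j))) as [xi [_ Hxi]].
  assert (Hr : 0 <= remainder Q (fun x => tpd 5 (M * x - INR j) / 120)).
  { rewrite Hxi. apply Rmult_le_pos; [lra|]. apply Rmult_le_pos; [apply pow_le; lra|].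
    apply tpd1_nonneg. }
  unfold remainder in Hr. rewrite RInt_bump, HQ in Hr by lra.
  assert (HY : 1 <= M - INR j).
  { apply le_INR in Hj. rewrite S_INR in Hj. fold M in Hj. lra. }
  pose proof (pos_INR j) as Hj0.
  set (Y := M - INR j) in *.
  assert (E1 : tpd 6 Y = 30 * Y ^ 4 + 30 * Y ^ 2 + 2).
  { unfold tpd. rewrite !tp_pos by lra. ring. }
  assert (E2 : 0 <= tpd 6 (- INR j)).
  { unfold tpd. rewrite (tp_neg 5 (- INR j)), (tp_neg 5 (- INR j - 1)) by lra.
    pose proof (tp_nonneg 6 (- INR j + 1)). lra. }
  assert (E3 : Rabs (psum (fun i => a i * (tpd 5 (M * tau i - INR j) / 120)) N
      - psum (fun i => a i * tcubic (t i - j)) N) <= S1 * (2 * M ^ 2)).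
  { apply psum_abs_close. intros i Hi. apply bump_tcubic_close; [fold M; lra|auto|auto]. }
  apply Rabs_le_between in E3.
  set (P1 := psum _ N) in Hr at 1. change (psum _ N) with P1 in E3 at 1.
  set (P2 := psum (fun i => a i * tcubic (t i - j)) N) in *.
  unfold k1. fold Y. fold P2.
  assert (E4 : 0 <= (Y ^ 4 / 24 + Y ^ 2 / 24 + 1 / 360) - M * P1).
  { rewrite E1 in Hr.
    replace ((Y ^ 4 / 24 + Y ^ 2 / 24 + 1 / 360) - M * P1) with
     (M * ((30 * Y ^ 4 + 30 * Y ^ 2 + 2) / (720 * M) - P1)) by (field; lra).
    apply Rmult_le_pos; [lra|].
    eapply Rle_trans; [exact Hr|]. apply Rplus_le_compat_r.
    unfold Rdiv. apply Rmult_le_compat_r; [|lra].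
    apply Rlt_le, Rinv_0_lt_compat. lra. }
  assert (E5 : M * P2 <= M * P1 + 2 * S1 * M ^ 3).
  { replace (M * P1 + 2 * S1 * M ^ 3) with (M * (P1 + S1 * (2 * M ^ 2))) by ring.
    apply Rmult_le_compat_l; lra. }
  assert (E6 : Y ^ 2 <= M ^ 2) by (apply pow_incr; split; [lra|unfold Y; lra]).
  assert (E7 : 8 * M ^ 2 <= M ^ 3) by nra.
  assert (64 <= M ^ 2) by nra. lra. }
set (k := fun j => if excluded_middle_informative (active m j) then k1 j else 0).
assert (Hk0 : forall j, 0 <= k j).
{ intros j. unfold k. destruct excluded_middle_informative as [Ha|]; [|lra].
  apply Hk1. unfold active in Ha. lia. }
set (T := hits (boundary_or m t) (N + 7)).
assert (HD : 9 <= INR N + 9) by (pose proof (pos_INR N); lra).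
set (D := INR N + 9) in *.
(* M / D is the average length of D segments on M grid points *)
assert (HMD : 0 <= M / D) by (apply Rle_mult_inv_pos; lra).
pose proof (discrete_kernel_bound m k T (M / D) ltac:(lia) HMD Hk0) as L1.
assert (L2 : psum (ind T) m <= D - 2).
{ eapply Rle_trans; [apply psum_ind_hits|]. rewrite plus_INR. unfold D. simpl. lra. }
assert (L3 : psum k m <= psum k1 m).
{ apply psum_le. intros j Hj. unfold k. destruct excluded_middle_informative; [lra|auto]. }
assert (L4 : psum k1 m <= M ^ 5 * c + (3 * S1 + 2) * M ^ 4).
{ assert (Ek : psum k1 m =
     / 24 * psum (fun j => (M - INR j) ^ 4) m
     + (- M) * psum (fun i => a i * tquartic (t i)) N
     + (2 * S1 + 1) * M ^ 4).
  { unfold k1.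
    rewrite (psum_ext _ (fun j => (/ 24 * (M - INR j) ^ 4
       + (- M) * psum (fun i => a i * tcubic (t i - j)) N) + (2 * S1 + 1) * M ^ 3 * 1))
      by (intros; unfold Rdiv; ring).
    rewrite !psum_plus, !psum_scal, psum_swap.
    rewrite (psum_ext (fun i => psum (fun j => a i * tcubic (t i - j)) m)
      (fun i => a i * tquartic (t i))).
    2:{ intros i Hi. rewrite psum_scal, psum_tcubic.
        rewrite (proj2 (Nat.sub_0_le (t i) m)) by auto.
        replace (tquartic 0) with 0 by (unfold tquartic; simpl; field). ring. }
    assert (P1 : psum (fun _ => 1) m = M).
    { unfold M. clear. induction m as [|n IH]; [reflexivity|]. cbn [psum]. rewrite IH, S_INR. ring. }
    rewrite P1. ring. }
  rewrite Ek. unfold M at 1. rewrite psum_quartic by lia. fold M. cbv zeta.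
  assert (Ec : c = 1 / 120 - psum (fun i => a i * (tau i ^ 4 / 24)) N).
  { rewrite (positive_definite4_value Q c Hc). unfold remainder.
    rewrite RInt_monomial, HQ. reflexivity. }
  assert (E3 : Rabs (psum (fun i => a i * ((M * tau i) ^ 4 / 24)) N
     - psum (fun i => a i * tquartic (t i)) N) <= S1 * M ^ 3).
  { apply psum_abs_close. intros i Hi. apply tquartic_close; [lra| |auto].
    apply le_INR. auto. }
  apply Rabs_le_between in E3.
  rewrite (psum_ext _ (fun i => M ^ 4 * (a i * (tau i ^ 4 / 24)))) in E3
    by (intros; unfold Rdiv; ring).
  rewrite psum_scal in E3. rewrite Ec.
  set (P1 := psum (fun i => a i * (tau i ^ 4 / 24)) N) in *.
  set (P2 := psum (fun i => a i * tquartic (t i)) N) in *.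
  assert (E4 : M * (M ^ 4 * P1 - P2) <= M * (S1 * M ^ 3)) by (apply Rmult_le_compat_l; lra).
  assert (E5 : M ^ 3 <= M ^ 4).
  { replace (M ^ 4) with (M * M ^ 3) by ring.
    assert (0 <= M ^ 3) by (apply pow_le; lra). nra. }
  assert (0 <= M ^ 4) by (apply pow_le; lra).
  replace (M - M) with 0 by ring.
  replace (/ 24 * (M * (M + 1) * (2 * M + 1) * (3 * M ^ 2 + 3 * M - 1) / 30
     - 0 * (0 + 1) * (2 * 0 + 1) * (3 * 0 ^ 2 + 3 * 0 - 1) / 30)) with
    (M ^ 5 / 120 + M ^ 4 / 48 + M ^ 3 / 72 - M / 720) by field.
  lra. }
assert (L5 : (M / D) ^ 4 / 144 * M - ((M / D) ^ 4 / 72 + (M / D) ^ 5 / 180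
     + 4 * ((M / D) ^ 4 / 144)) * D <= psum k m).
{ assert (H4 : 0 <= (M / D) ^ 4) by (apply pow_le; lra).
  assert (H5 : 0 <= (M / D) ^ 5) by (apply pow_le; lra).
  eapply Rle_trans; [|apply L1].
  - fold M. assert (0 <= ((M / D) ^ 4 / 72 + (M / D) ^ 5 / 180 + 4 * ((M / D) ^ 4 / 144))) by lra.
    nra.
  - intros j Hj. unfold k. destruct excluded_middle_informative; [contradiction|reflexivity].
  - intros j Hj Tj.
    pose proof (hits_false _ _ _ Tj) as HT.
    assert (Hj1 : (4 <= j < m - 3)%nat).
    { pose proof (HT 0 ltac:(lia))%nat as G0. pose proof (HT 1 ltac:(lia))%nat as G1.
      pose proof (HT 2 ltac:(lia))%nat as G2. pose proof (HT 3 ltac:(lia))%nat as G3.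
      pose proof (HT 4 ltac:(lia))%nat as G4. pose proof (HT 5 ltac:(lia))%nat as G5.
      pose proof (HT 6 ltac:(lia))%nat as G6. cbn in *. lia. }
    split; [unfold active; lia|].
    transitivity (diff2 (diff2 k1) j).
    + unfold diff2, k.
      repeat (destruct excluded_middle_informative as [_|Hn];
        [|exfalso; apply Hn; unfold active; lia]). reflexivity.
    + transitivity (diff2 (diff2 (fun i => (M - INR i) ^ 4 / 24)) j
       - M * diff2 (diff2 (fun l => psum (fun i => a i * tcubic (t i - l)) N)) j).
      * unfold diff2, k1. ring.
      * rewrite diff4_quartic, diff4_psum_tcubic; [ring|lia| |lia].
        intros i Hi. exact (HT (7 + i)%nat ltac:(lia)). }
replace ((M / D) ^ 4 / 144 * M - ((M / D) ^ 4 / 72 + (M / D) ^ 5 / 180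
     + 4 * ((M / D) ^ 4 / 144)) * D) with
  (1 / (720 * D ^ 4) * M ^ 5 - M ^ 4 / (24 * D ^ 3)) in L5 by (field; lra).
lra.
Qed.

Lemma error_constant_bound_psum : 1 / (720 * (INR N + 9) ^ 4) <= c.
Proof.
apply Rnot_lt_le. intros L.
set (g := 1 / (720 * (INR N + 9) ^ 4) - c).
assert (Hg : 0 < g) by (unfold g; lra).
set (X := 1 / (24 * (INR N + 9) ^ 3) + (3 * S1 + 2)).
destruct (nfloor_ex (Rmax 8 (X / g))) as [p Hp].
{ eapply Rle_trans; [|apply Rmax_l]. lra. }
set (m := S p).
assert (HM : Rmax 8 (X / g) < INR m) by (unfold m; rewrite S_INR; lra).
pose proof (Rmax_l 8 (X / g)). pose proof (Rmax_r 8 (X / g)).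
assert (Hm : (8 <= m)%nat).
{ apply INR_le. simpl (INR 8). lra. }
pose proof (grid_kernel_bound m Hm) as G.
assert (H4 : 0 < INR m ^ 4) by (apply pow_lt; lra).
assert (HX : X < INR m * g).
{ replace X with (X / g * g) by (field; lra). apply Rmult_lt_compat_r; lra. }
assert (E : INR m ^ 4 * (INR m * g - X) <= 0).
{ unfold g, X. unfold Rdiv in G. rewrite Rmult_1_l in G. unfold Rdiv. rewrite !Rmult_1_l.
  ring_simplify in G. ring_simplify. lra. }
nra.
Qed.
End LowerBound.

(** Every positive definite formula of order 4 with N nodes has an error constant of
    at least 1 / (720 (N+9)^4): the 9 accounts for the seven boundary indices and two
    extra segments. *)
Lemma error_constant_lower_bound N Q c :
  is_quadrature N Q -> positive_definite4_with Q c -> 1 / (720 * (INR N + 9) ^ 4) <= c.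
Proof.
intros [a [tau [Htau [_ HQ]]]] Hc.
apply (error_constant_bound_psum N Q c (fun i => a (S i)) (fun i => tau (S i))).
- intros i Hi. apply Htau. lia.
- intros f. rewrite HQ, sum_n_m_psum. reflexivity.
- exact Hc.
Qed.

(** * Functions of class C^4 and Peano kernel pieces *)

(** Projection onto [0, 1], used to extend functions continuously to the line. *)
Definition clamp (x : R) : R := Rmax 0 (Rmin 1 x).

Lemma clamp_I01 x : I01 (clamp x).
Proof. unfold I01, clamp, Rmax, Rmin. repeat destruct Rle_dec; lra. Qed.

Lemma clamp_id x : I01 x -> clamp x = x.
Proof. unfold I01, clamp, Rmax, Rmin. repeat destruct Rle_dec; lra. Qed.

Lemma clamp_lipschitz x y : Rabs (clamp y - clamp x) <= Rabs (y - x).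
Proof. unfold clamp, Rmax, Rmin, Rabs. repeat destruct Rle_dec; repeat destruct Rcase_abs; lra. Qed.

Lemma continuous_clamp f :
  (forall x, I01 x -> continue_in f I01 x) -> forall x, continuous (fun y => f (clamp y)) x.
Proof.
intros H x. apply continuity_pt_filterlim. intros eps He.
destruct (H _ (clamp_I01 x) eps He) as [al [Ha1 Ha2]].
exists al. split; [exact Ha1|]. intros y [_ Hy]. simpl in *. unfold Rdist in *.
destruct (Req_dec (clamp y) (clamp x)) as [E|Ne].
- rewrite E. unfold Rminus. rewrite Rplus_opp_r, Rabs_R0. exact He.
- apply Ha2. split; [split; [apply clamp_I01|apply not_eq_sym, Ne]|].
  eapply Rle_lt_trans; [apply clamp_lipschitz|exact Hy].
Qed.

Lemma is_derive_clamp f d x : 0 < x < 1 -> D_in f d I01 x ->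
  is_derive (fun y => f (clamp y)) x (d (clamp x)).
Proof.
intros Hx H. apply is_derive_Reals. intros eps He.
destruct (H eps He) as [al [Ha1 Ha2]].
assert (P : 0 < Rmin al (Rmin x (1 - x))) by (repeat apply Rmin_glb_lt; lra).
exists (mkposreal _ P). intros h Hh Hl. simpl in Hl.
pose proof (Rmin_l al (Rmin x (1 - x))). pose proof (Rmin_r al (Rmin x (1 - x))).
pose proof (Rmin_l x (1 - x)). pose proof (Rmin_r x (1 - x)).
assert (Hb : - Rmin x (1 - x) < h < Rmin x (1 - x)) by (apply Rabs_lt_between; lra).
assert (I1 : I01 (x + h)) by (unfold I01; lra).
rewrite !clamp_id by (try exact I1; unfold I01; lra).
specialize (Ha2 (x + h)). simpl in Ha2. unfold Rdist in Ha2.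
replace (x + h - x) with h in Ha2 by ring. apply Ha2.
split; [split; [exact I1|lra]|lra].
Qed.

(** g0, ..., g4 are successive derivatives on the open unit interval, and g0, ..., g3
    are continuous on the line. *)
Definition smooth4 (g0 g1 g2 g3 g4 : R -> R) : Prop :=
  (forall x, continuous g0 x /\ continuous g1 x /\ continuous g2 x /\ continuous g3 x) /\
  (forall x, 0 < x < 1 -> is_derive g0 x (g1 x) /\ is_derive g1 x (g2 x) /\
     is_derive g2 x (g3 x) /\ is_derive g3 x (g4 x)).

Lemma C4_with_smooth4 f f4 : C4_with f f4 ->
  (exists f1 f2 f3, smooth4 (fun x => f (clamp x)) f1 f2 f3 (fun x => f4 (clamp x))) /\
  forall x, continuous (fun x => f4 (clamp x)) x.
Proof.
intros [f1 [f2 [f3 H]]]. split.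
- exists (fun x => f1 (clamp x)), (fun x => f2 (clamp x)), (fun x => f3 (clamp x)). split.
  + intros x. refine (conj _ (conj _ (conj _ _))); apply continuous_clamp; intros y Hy;
      destruct (H y Hy) as [H1 [H2 [H3 [H4 _]]]]; eapply cont_deriv; eassumption.
  + intros x Hx. destruct (H x) as [H1 [H2 [H3 [H4 _]]]]; [unfold I01; lra|].
    refine (conj _ (conj _ (conj _ _))); apply is_derive_clamp; assumption.
- apply continuous_clamp. intros y Hy. apply (H y Hy).
Qed.

Lemma smooth4_sub_monomial g0 g1 g2 g3 g4 s l : smooth4 g0 g1 g2 g3 g4 ->
  smooth4 (fun x => s * g0 x - l * (x ^ 4 / 24)) (fun x => s * g1 x - l * (x ^ 3 / 6))
    (fun x => s * g2 x - l * (x ^ 2 / 2)) (fun x => s * g3 x - l * x)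
    (fun x => s * g4 x - l).
Proof.
intros [Hc Hd].
assert (Cm : forall g h : R -> R, (forall x, continuous g x) -> (forall x, ex_derive h x) ->
   forall x, continuous (fun x => s * g x - l * h x) x).
{ intros g h Hg Hh x. apply (continuous_minus (V := R_NormedModule)).
  - apply (continuous_scal_r s (V := R_NormedModule)), Hg.
  - apply (continuous_scal_r l (V := R_NormedModule)).
    apply (ex_derive_continuous (V := R_NormedModule)), Hh. }
assert (Dm : forall (g h : R -> R) (x u v w : R), is_derive g x u -> is_derive h x v ->
   w = s * u - l * v -> is_derive (fun x => s * g x - l * h x) x w).
{ intros g h x u v w Hg Hh ->. apply @is_derive_minus; apply is_derive_scal; assumption. }
split.
- intros x. refine (conj _ (conj _ (conj _ _))); apply Cm;
    try (intros y; apply Hc); intros y; auto_derive; exact I.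
- intros x Hx. destruct (Hd x Hx) as [D1 [D2 [D3 D4]]].
  refine (conj _ (conj _ (conj _ _))).
  + apply (Dm g0 (fun x => x ^ 4 / 24) x _ (x ^ 3 / 6) _ D1); [auto_derive; [exact I|field]|ring].
  + apply (Dm g1 (fun x => x ^ 3 / 6) x _ (x ^ 2 / 2) _ D2); [auto_derive; [exact I|field]|ring].
  + apply (Dm g2 (fun x => x ^ 2 / 2) x _ x _ D3); [auto_derive; [exact I|field]|ring].
  + apply (Dm g3 (fun x => x) x _ 1 _ D4); [auto_derive; [exact I|field]|ring].
Qed.

Lemma smooth4_reflect g0 g1 g2 g3 g4 : smooth4 g0 g1 g2 g3 g4 ->
  smooth4 (fun x => g0 (1 - x)) (fun x => - g1 (1 - x)) (fun x => g2 (1 - x))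
    (fun x => - g3 (1 - x)) (fun x => g4 (1 - x)).
Proof.
intros [Hc Hd].
assert (Cr : forall (g : R -> R) x, continuous g (1 - x) -> continuous (fun x => g (1 - x)) x).
{ intros g x H. apply (continuous_comp (fun x => 1 - x) g); [|exact H].
  apply (ex_derive_continuous (V := R_NormedModule)). auto_derive. exact I. }
assert (Dr : forall (g : R -> R) x u, is_derive g (1 - x) u ->
   is_derive (fun x => g (1 - x)) x (- u)).
{ intros g x u H. replace (- u) with (scal (-1) u) by (unfold scal; simpl; unfold mult; simpl; ring).
  apply (is_derive_comp g (fun x => 1 - x)); [exact H|]. auto_derive; [exact I|ring]. }
split.
- intros x. destruct (Hc (1 - x)) as [C0 [C1 [C2 C3]]]. refine (conj _ (conj _ (conj _ _))).
  + apply Cr, C0.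
  + apply (continuous_opp (V := R_NormedModule)), Cr, C1.
  + apply Cr, C2.
  + apply (continuous_opp (V := R_NormedModule)), Cr, C3.
- intros x Hx. destruct (Hd (1 - x) ltac:(lra)) as [D1 [D2 [D3 D4]]]. refine (conj _ (conj _ (conj _ _))).
  + apply Dr, D1.
  + replace (g2 (1 - x)) with (opp (- g2 (1 - x))) by (unfold opp; simpl; ring).
    apply @is_derive_opp, Dr, D2.
  + apply Dr, D3.
  + replace (g4 (1 - x)) with (opp (- g4 (1 - x))) by (unfold opp; simpl; ring).
    apply @is_derive_opp, Dr, D4.
Qed.

(** x^4/24 plus an arbitrary cubic: the shape of a piece of a Peano kernel. *)
Definition quartic (A B C D x : R) : R :=
  x ^ 4 / 24 + A * x ^ 3 / 6 + B * x ^ 2 / 2 + C * x + D.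
(** p g''' - p' g'' + p'' g' - p''' g for p = quartic A B C D; its derivative is
    p g'''' - g because p'''' = 1. *)
Definition peano_primitive (A B C D : R) (g0 g1 g2 g3 : R -> R) (x : R) : R :=
  quartic A B C D x * g3 x - (x ^ 3 / 6 + A * x ^ 2 / 2 + B * x + C) * g2 x
  + (x ^ 2 / 2 + A * x + B) * g1 x - (x + A) * g0 x.

(** Integration by parts of the nonnegative quantity int p g''''; the monotonicity
    form needs no integrability of g''''. *)
Lemma peano_piece A B C D g0 g1 g2 g3 g4 a b :
  smooth4 g0 g1 g2 g3 g4 -> (forall x, 0 <= g4 x) ->
  0 <= a <= b -> b <= 1 -> (forall x, a <= x <= b -> 0 <= quartic A B C D x) ->
  0 <= RInt g0 a b + peano_primitive A B C D g0 g1 g2 g3 b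
       - peano_primitive A B C D g0 g1 g2 g3 a.
Proof.
intros [Hc Hd] H4 Hab Hb Hp.
assert (Ex : forall u v, ex_RInt g0 u v).
{ intros u v. apply (ex_RInt_continuous (V := R_CompleteNormedModule)).
  intros z _. apply Hc. }
set (F := fun x => RInt g0 a x + peano_primitive A B C D g0 g1 g2 g3 x).
assert (DI : forall x, is_derive (fun x => RInt g0 a x) x (g0 x)).
{ intros x. apply (is_derive_RInt (V := R_NormedModule) g0 _ a); [|apply Hc].
  exists (mkposreal 1 Rlt_0_1). intros y _. apply (RInt_correct (V := R_CompleteNormedModule)), Ex. }
assert (Pd : forall p dp : R -> R, forall g dg x, is_derive p x (dp x) -> is_derive g x dg ->
   is_derive (fun x => p x * g x) x (dp x * g x + p x * dg)).
{ intros p dp g dg x H1 H2.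
  apply (is_derive_mult p g x (dp x) dg); [exact H1|exact H2|]. intros; apply Rmult_comm. }
assert (DF : forall x, 0 < x < 1 -> is_derive F x (quartic A B C D x * g4 x)).
{ intros x Hx. destruct (Hd x Hx) as [D1 [D2 [D3 D4]]].
  set (q1 := fun x => x ^ 3 / 6 + A * x ^ 2 / 2 + B * x + C).
  set (q2 := fun x => x ^ 2 / 2 + A * x + B).
  set (q3 := fun x => x + A).
  assert (E0 : is_derive (quartic A B C D) x (q1 x))
    by (unfold quartic, q1; auto_derive; [exact I|field]).
  assert (E1 : is_derive q1 x (q2 x)) by (unfold q1, q2; auto_derive; [exact I|field]).
  assert (E2 : is_derive q2 x (q3 x)) by (unfold q2, q3; auto_derive; [exact I|field]).
  assert (E3 : is_derive q3 x ((fun _ => 1) x)) by (unfold q3; auto_derive; [exact I|ring]).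
  pose proof (Pd _ _ _ _ _ E0 D4) as P0. pose proof (Pd _ _ _ _ _ E1 D3) as P1.
  pose proof (Pd _ _ _ _ _ E2 D2) as P2. pose proof (Pd _ _ _ _ _ E3 D1) as P3.
  pose proof (is_derive_plus _ _ _ _ _ (DI x)
    (is_derive_minus _ _ _ _ _ (is_derive_plus _ _ _ _ _ (is_derive_minus _ _ _ _ _ P0 P1) P2) P3)) as PF.
  unfold plus, minus, opp in PF; simpl in PF.
  replace (quartic A B C D x * g4 x) with
   (g0 x + (q1 x * g3 x + quartic A B C D x * g4 x + - (q2 x * g2 x + q1 x * g3 x)
      + (q3 x * g1 x + q2 x * g2 x) + - (1 * g0 x + q3 x * g1 x))) by ring.
  exact PF. }
assert (CF : forall x, continuity_pt F x).
{ intros x. apply continuity_pt_filterlim.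
  assert (Cp : forall p g : R -> R, ex_derive p x -> continuous g x -> continuous (fun x => p x * g x) x).
  { intros p g H1 H2. apply (continuous_mult p g); [|exact H2].
    apply (ex_derive_continuous (V := R_NormedModule)), H1. }
  destruct (Hc x) as [C0 [C1 [C2 C3]]].
  apply (continuous_plus (V := R_NormedModule)).
  - apply (ex_derive_continuous (V := R_NormedModule)). exists (g0 x). apply DI.
  - unfold peano_primitive.
    apply (continuous_minus (V := R_NormedModule)); [apply (continuous_plus (V := R_NormedModule));
      [apply (continuous_minus (V := R_NormedModule))|]|]; apply Cp; try assumption;
      unfold quartic; auto_derive; exact I. }
destruct (MVT_gen F a b (fun x => quartic A B C D x * g4 x)) as [z [Hz Ez]].
{ rewrite Rmin_left, Rmax_right by lra. intros x Hx. apply DF. lra. }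
{ intros x _. apply CF. }
assert (E : F b - F a = RInt g0 a b + peano_primitive A B C D g0 g1 g2 g3 b
       - peano_primitive A B C D g0 g1 g2 g3 a).
{ unfold F. rewrite RInt_point. unfold zero; simpl. ring. }
rewrite <- E, Ez. rewrite Rmin_left, Rmax_right in Hz by lra.
apply Rmult_le_pos; [|lra]. apply Rmult_le_pos; [apply Hp; lra|apply H4].
Qed.

(** * Positive definiteness *)

(** The Peano kernel on the three intervals [1/2, 1], [1, 3/2], [3/2, 5/2], in units
    of h; on [0, 1/2] it is u^4/24. *)
Lemma boundary_kernel_1 u : 1 / 2 <= u <= 1 ->
  0 <= u ^ 4 / 24 - 251 / 192 * (u - 1 / 2) ^ 3 / 6.
Proof.
intros H. set (s := u - 1 / 2). assert (Hs : 0 <= s <= 1 / 2) by (unfold s; lra).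
replace u with (s + 1 / 2) by (unfold s; ring).
assert (0 <= s ^ 2 * (1 / 2 - s)) by (apply Rmult_le_pos; [apply pow2_ge_0|lra]).
assert (0 <= s ^ 4) by (apply pow_le; lra). nra.
Qed.

Lemma boundary_kernel_2 u : 1 <= u <= 3 / 2 ->
  0 <= u ^ 4 / 24 - 251 / 192 * (u - 1 / 2) ^ 3 / 6 + 43 / 72 * (u - 1) ^ 3 / 6.
Proof.
intros H. set (s := u - 1). assert (Hs : 0 <= s <= 1 / 2) by (unfold s; lra).
replace (u - 1 / 2) with (s + 1 / 2) by (unfold s; field).
replace u with (s + 1) by (unfold s; ring).
assert (0 <= s ^ 4) by (apply pow_le; lra). assert (0 <= s ^ 3) by (apply pow_le; lra).
nra.
Qed.

Lemma boundary_kernel_3 u : 3 / 2 <= u <= 5 / 2 ->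
  0 <= u ^ 4 / 24 - 251 / 192 * (u - 1 / 2) ^ 3 / 6 + 43 / 72 * (u - 1) ^ 3 / 6
     - 127 / 96 * (u - 3 / 2) ^ 3 / 6.
Proof.
intros H. set (s := 5 / 2 - u). assert (Hs : 0 <= s <= 1) by (unfold s; lra).
replace u with (5 / 2 - s) by (unfold s; ring).
(* the double zero at 5/2 makes the kernel join the interior pattern *)
match goal with |- 0 <= ?e => replace e with (s ^ 2 * (s ^ 2 / 24 - 269 / 3456 * s + 1 / 24)) by field end.
apply Rmult_le_pos; [apply pow2_ge_0|]. nra.
Qed.

(** Passing a node t with weight w subtracts w (x - t)^3/6 from the kernel; the
    boundary terms on the two sides differ by w g0 t. *)
Lemma peano_primitive_jump A B C D w t g0 g1 g2 g3 :
  peano_primitive (A - w) (B + w * t) (C - w * t ^ 2 / 2) (D + w * t ^ 3 / 6) g0 g1 g2 g3 t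
  = peano_primitive A B C D g0 g1 g2 g3 t + w * g0 t.
Proof. unfold peano_primitive, quartic. field. Qed.

Lemma RInt_split (g : R -> R) a b c : (forall x, continuous g x) ->
  RInt g a c = RInt g a b + RInt g b c.
Proof.
intros H. symmetry. apply (RInt_Chasles (V := R_CompleteNormedModule));
  apply (ex_RInt_continuous (V := R_CompleteNormedModule)); intros; apply H.
Qed.

(** The weight 269/576 of the last node is 557/576 - 1/2: the other half belongs to
    the first interior interval. *)
Lemma boundary_remainder_nonneg g0 g1 g2 g3 g4 h :
  smooth4 g0 g1 g2 g3 g4 -> (forall x, 0 <= g4 x) -> 0 < h -> 5 * h / 2 <= 1 ->
  0 <= RInt g0 0 (5 * h / 2)
    - h * (251 / 192 * g0 (h / 2) - 43 / 72 * g0 h + 127 / 96 * g0 (3 * h / 2)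
           + 269 / 576 * g0 (5 * h / 2))
    + h ^ 2 / 12 * g1 (5 * h / 2).
Proof.
intros Hs H4 Hh H1.
assert (Hc : forall x, continuous g0 x) by apply Hs.
set (w1 := 251 / 192 * h). set (w2 := - (43 / 72 * h)). set (w3 := 127 / 96 * h).
set (A1 := 0 - w1). set (B1 := 0 + w1 * (h / 2)).
set (C1 := 0 - w1 * (h / 2) ^ 2 / 2). set (D1 := 0 + w1 * (h / 2) ^ 3 / 6).
set (A2 := A1 - w2). set (B2 := B1 + w2 * h).
set (C2 := C1 - w2 * h ^ 2 / 2). set (D2 := D1 + w2 * h ^ 3 / 6).
set (A3 := A2 - w3). set (B3 := B2 + w3 * (3 * h / 2)).
set (C3 := C2 - w3 * (3 * h / 2) ^ 2 / 2). set (D3 := D2 + w3 * (3 * h / 2) ^ 3 / 6).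
assert (Hu : forall x a b, a * h <= x <= b * h -> a <= x / h <= b).
{ intros x a b [Ha Hb]. split.
  - apply Rmult_le_reg_r with h; [exact Hh|]. replace (x / h * h) with x by (field; lra). exact Ha.
  - apply Rmult_le_reg_r with h; [exact Hh|]. replace (x / h * h) with x by (field; lra). exact Hb. }
assert (Hh4 : 0 <= h ^ 4) by (apply pow_le; lra).
pose proof (peano_piece 0 0 0 0 g0 g1 g2 g3 g4 0 (h / 2) Hs H4 ltac:(lra) ltac:(lra)) as P0.
pose proof (peano_piece A1 B1 C1 D1 g0 g1 g2 g3 g4 (h / 2) h Hs H4 ltac:(lra) ltac:(lra)) as P1.
pose proof (peano_piece A2 B2 C2 D2 g0 g1 g2 g3 g4 h (3 * h / 2) Hs H4 ltac:(lra) ltac:(lra)) as P2.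
pose proof (peano_piece A3 B3 C3 D3 g0 g1 g2 g3 g4 (3 * h / 2) (5 * h / 2) Hs H4
  ltac:(lra) ltac:(lra)) as P3.
specialize (P0 ltac:(intros x Hx; unfold quartic; assert (0 <= x ^ 4) by (apply pow_le; lra); lra)).
assert (Q1 : forall x, h / 2 <= x <= h -> 0 <= quartic A1 B1 C1 D1 x).
{ intros x Hx. pose proof (Hu x (1 / 2) 1 ltac:(lra)) as Hux.
  match goal with |- 0 <= ?e => replace e with (h ^ 4 *
    ((x / h) ^ 4 / 24 - 251 / 192 * (x / h - 1 / 2) ^ 3 / 6))
    by (unfold quartic, A1, B1, C1, D1, w1; field; lra) end.
  apply Rmult_le_pos; [exact Hh4|apply boundary_kernel_1, Hux]. }
assert (Q2 : forall x, h <= x <= 3 * h / 2 -> 0 <= quartic A2 B2 C2 D2 x).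
{ intros x Hx. pose proof (Hu x 1 (3 / 2) ltac:(lra)) as Hux.
  match goal with |- 0 <= ?e => replace e with (h ^ 4 *
    ((x / h) ^ 4 / 24 - 251 / 192 * (x / h - 1 / 2) ^ 3 / 6 + 43 / 72 * (x / h - 1) ^ 3 / 6))
    by (unfold quartic, A2, B2, C2, D2, A1, B1, C1, D1, w1, w2; field; lra) end.
  apply Rmult_le_pos; [exact Hh4|apply boundary_kernel_2, Hux]. }
assert (Q3 : forall x, 3 * h / 2 <= x <= 5 * h / 2 -> 0 <= quartic A3 B3 C3 D3 x).
{ intros x Hx. pose proof (Hu x (3 / 2) (5 / 2) ltac:(lra)) as Hux.
  match goal with |- 0 <= ?e => replace e with (h ^ 4 *
    ((x / h) ^ 4 / 24 - 251 / 192 * (x / h - 1 / 2) ^ 3 / 6 + 43 / 72 * (x / h - 1) ^ 3 / 6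
     - 127 / 96 * (x / h - 3 / 2) ^ 3 / 6))
    by (unfold quartic, A3, B3, C3, D3, A2, B2, C2, D2, A1, B1, C1, D1, w1, w2, w3; field; lra) end.
  apply Rmult_le_pos; [exact Hh4|apply boundary_kernel_3, Hux]. }
specialize (P1 Q1). specialize (P2 Q2). specialize (P3 Q3).
unfold A1, B1, C1, D1 in P1. rewrite (peano_primitive_jump 0 0 0 0 w1 (h / 2)) in P1.
fold A1 B1 C1 D1 in P1.
unfold A2, B2, C2, D2 in P2. rewrite (peano_primitive_jump A1 B1 C1 D1 w2 h) in P2.
fold A2 B2 C2 D2 in P2.
unfold A3, B3, C3, D3 in P3. rewrite (peano_primitive_jump A2 B2 C2 D2 w3 (3 * h / 2)) in P3.
fold A3 B3 C3 D3 in P3.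
assert (Z : peano_primitive 0 0 0 0 g0 g1 g2 g3 0 = 0).
{ unfold peano_primitive, quartic. field. }
(* the kernel joins the interior one with K = K' = 0 at 5 h / 2 *)
assert (Z' : peano_primitive A3 B3 C3 D3 g0 g1 g2 g3 (5 * h / 2)
   = h ^ 2 / 12 * g1 (5 * h / 2) - 269 / 576 * h * g0 (5 * h / 2)).
{ unfold peano_primitive, quartic, A3, B3, C3, D3, A2, B2, C2, D2, A1, B1, C1, D1, w1, w2, w3.
  field. }
rewrite Z in P0. rewrite Z' in P3.
rewrite (RInt_split g0 0 (h / 2) (5 * h / 2) Hc), (RInt_split g0 (h / 2) h (5 * h / 2) Hc),
  (RInt_split g0 h (3 * h / 2) (5 * h / 2) Hc).
unfold w1, w2, w3 in P1, P2, P3. lra.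
Qed.

(** Corrected trapezoidal rule, with kernel (x - a)^2 (x - a - h)^2 / 24. *)
Lemma interior_step_nonneg g0 g1 g2 g3 g4 a h :
  smooth4 g0 g1 g2 g3 g4 -> (forall x, 0 <= g4 x) -> 0 <= a -> 0 < h -> a + h <= 1 ->
  0 <= RInt g0 a (a + h) - h / 2 * (g0 a + g0 (a + h))
    + h ^ 2 / 12 * (g1 (a + h) - g1 a).
Proof.
intros Hs H4 Ha Hh H1.
set (b := a + h).
(* the coefficients of (x - a)^2 (x - b)^2 / 24 *)
pose proof (peano_piece (- (a + b) / 2) ((a ^ 2 + 4 * a * b + b ^ 2) / 12)
  (- (a * b * (a + b)) / 12) (a ^ 2 * b ^ 2 / 24) g0 g1 g2 g3 g4 a b Hs H4
  ltac:(unfold b; lra) H1) as P.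
assert (Pos : 0 <= RInt g0 a b + peano_primitive (- (a + b) / 2) ((a ^ 2 + 4 * a * b + b ^ 2) / 12)
   (- (a * b * (a + b)) / 12) (a ^ 2 * b ^ 2 / 24) g0 g1 g2 g3 b
   - peano_primitive (- (a + b) / 2) ((a ^ 2 + 4 * a * b + b ^ 2) / 12)
   (- (a * b * (a + b)) / 12) (a ^ 2 * b ^ 2 / 24) g0 g1 g2 g3 a).
{ apply P. intros x _.
  match goal with |- 0 <= ?e => replace e with (((x - a) * (x - b)) ^ 2 / 24)
    by (unfold quartic; field) end.
  pose proof (pow2_ge_0 ((x - a) * (x - b))). lra. }
match type of Pos with 0 <= ?e => match goal with |- 0 <= ?d => replace d with e; [exact Pos|] end end.
unfold peano_primitive, quartic.
assert (Eh : h = b - a) by (unfold b; ring). clearbody b. subst h. field.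
Qed.

Lemma interior_remainder_nonneg g0 g1 g2 g3 g4 a h q :
  smooth4 g0 g1 g2 g3 g4 -> (forall x, 0 <= g4 x) -> 0 <= a -> 0 < h -> a + INR q * h <= 1 ->
  0 <= RInt g0 a (a + INR q * h)
    - h * (psum (fun i => g0 (a + INR i * h)) q - g0 a / 2 + g0 (a + INR q * h) / 2)
    + h ^ 2 / 12 * (g1 (a + INR q * h) - g1 a).
Proof.
intros Hs H4 Ha Hh. assert (Hc : forall x, continuous g0 x) by apply Hs.
induction q as [|q IH]; intros Hq.
- simpl. rewrite Rmult_0_l, Rplus_0_r, RInt_point. unfold zero; simpl. lra.
- rewrite S_INR in *. pose proof (pos_INR q). specialize (IH ltac:(nra)).
  pose proof (interior_step_nonneg g0 g1 g2 g3 g4 (a + INR q * h) h Hs H4 ltac:(nra) Hh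
    ltac:(lra)) as P.
  replace (a + (INR q + 1) * h) with (a + INR q * h + h) by ring.
  rewrite (RInt_split g0 a (a + INR q * h) _ Hc). cbn [psum]. lra.
Qed.

Lemma sum_n_m_shift (u : nat -> R) k r :
  sum_n_m u k (k + r) = psum (fun i => u (k + i)%nat) (S r).
Proof.
induction r as [|r IH].
- rewrite Nat.add_0_r, sum_n_n. simpl. rewrite Nat.add_0_r. ring.
- rewrite Nat.add_succ_r, sum_n_Sm by lia. rewrite IH. cbn [psum].
  rewrite Nat.add_succ_r. reflexivity.
Qed.

(** The formula Q_{n+2} for n = r + 7, in terms of h = 1/n and the first node 5h/2 of
    the equidistant part. *)
Lemma Qf_psum r f : let h := / INR (r + 7) in
  Qf (r + 7) f =
    h * (251 / 192 * (f (h / 2) + f (1 - h / 2)) - 43 / 72 * (f h + f (1 - h))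
         + 127 / 96 * (f (3 * h / 2) + f (1 - 3 * h / 2))
         + 557 / 576 * (f (5 * h / 2) + f (1 - 5 * h / 2))
         + psum (fun i => f (5 * h / 2 + INR (S i) * h)) (S r)).
Proof.
intros h. unfold Qf, Defs.sigma.
assert (Hn : 0 < INR (r + 7)) by (apply lt_0_INR; lia).
replace (r + 7 - 3)%nat with (4 + r)%nat by lia.
rewrite sum_n_m_shift.
replace (1 / (2 * INR (r + 7))) with (h / 2) by (unfold h; field; lra).
replace (1 / INR (r + 7)) with h by (unfold h; field; lra).
replace (3 / (2 * INR (r + 7))) with (3 * h / 2) by (unfold h; field; lra).
replace (5 / (2 * INR (r + 7))) with (5 * h / 2) by (unfold h; field; lra).
rewrite (psum_ext _ (fun i => f (5 * h / 2 + INR (S i) * h))).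
2:{ intros i _. f_equal. rewrite (plus_INR 4 i), (S_INR i). simpl (INR 4). unfold h. field. lra. }
replace (251 / (192 * INR (r + 7))) with (h * (251 / 192)) by (unfold h; field; lra).
replace (43 / (72 * INR (r + 7))) with (h * (43 / 72)) by (unfold h; field; lra).
replace (127 / (96 * INR (r + 7))) with (h * (127 / 96)) by (unfold h; field; lra).
replace (557 / (576 * INR (r + 7))) with (h * (557 / 576)) by (unfold h; field; lra).
ring.
Qed.

Lemma psum_first f n : psum f (S n) = f 0%nat + psum (fun i => f (S i)) n.
Proof. induction n as [|n IH]; [simpl; ring|]. cbn [psum] in *. rewrite IH. ring. Qed.

Lemma RInt_reflect (g : R -> R) a b : (forall x, continuous g x) ->
  RInt (fun x => g (1 - x)) a b = RInt g (1 - b) (1 - a).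
Proof.
intros Hc.
assert (E : RInt (fun x => scal (-1) (g (-1 * x + 1))) a b = RInt g (-1 * a + 1) (-1 * b + 1)).
{ apply (RInt_comp_lin (V := R_CompleteNormedModule) g (-1) 1 a b).
  apply (ex_RInt_continuous (V := R_CompleteNormedModule)). intros; apply Hc. }
replace (-1 * a + 1) with (1 - a) in E by ring. replace (-1 * b + 1) with (1 - b) in E by ring.
rewrite <- (opp_RInt_swap g).
2:{ apply (ex_RInt_continuous (V := R_CompleteNormedModule)). intros; apply Hc. }
rewrite <- E.
rewrite <- (RInt_opp (V := R_CompleteNormedModule) (fun x => scal (-1) (g (-1 * x + 1)))).
- apply RInt_ext. intros x _. unfold opp, scal; simpl. unfold mult; simpl.
  replace (-1 * x + 1) with (1 - x) by ring. ring.
- apply (ex_RInt_continuous (V := R_CompleteNormedModule)). intros z _.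
  apply (continuous_scal_r (-1) (V := R_NormedModule)).
  apply (continuous_comp (fun x => -1 * x + 1) g); [|apply Hc].
  apply (ex_derive_continuous (V := R_NormedModule)). auto_derive. exact I.
Qed.

Lemma remainder_nonneg n g0 g1 g2 g3 g4 : (7 <= n)%nat ->
  smooth4 g0 g1 g2 g3 g4 -> (forall x, 0 <= g4 x) -> 0 <= remainder (Qf n) g0.
Proof.
intros Hn Hs H4. replace n with (n - 7 + 7)%nat by lia. set (r := (n - 7)%nat).
unfold remainder. rewrite Qf_psum. cbv zeta. set (h := / INR (r + 7)).
assert (HN : 7 <= INR (r + 7)) by (rewrite plus_INR; pose proof (pos_INR r); simpl; lra).
assert (Hh : 0 < h) by (apply Rinv_0_lt_compat; lra).
assert (Hr : (INR r + 7) * h = 1).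
{ unfold h. rewrite plus_INR. simpl (INR 7). field. rewrite plus_INR in HN. simpl (INR 7) in HN. lra. }
pose proof (pos_INR r) as Hr0.
assert (Hh7 : 7 * h <= 1) by nra.
assert (Hc : forall x, continuous g0 x) by apply Hs.
pose proof (boundary_remainder_nonneg _ _ _ _ _ h Hs H4 Hh ltac:(lra)) as L.
pose proof (boundary_remainder_nonneg _ _ _ _ _ h (smooth4_reflect _ _ _ _ _ Hs)
  (fun x => H4 (1 - x)) Hh ltac:(lra)) as Rt.
cbv beta in Rt. rewrite (RInt_reflect g0 _ _ Hc), Rminus_0_r in Rt.
assert (Eb : 5 * h / 2 + INR (S (S r)) * h = 1 - 5 * h / 2) by (rewrite !S_INR; lra).
pose proof (interior_remainder_nonneg _ _ _ _ _ (5 * h / 2) h (S (S r)) Hs H4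
  ltac:(lra) Hh ltac:(lra)) as Md.
rewrite psum_first, Eb in Md. simpl (INR 0) in Md. rewrite Rmult_0_l, Rplus_0_r in Md.
rewrite (RInt_split g0 0 (5 * h / 2) 1 Hc), (RInt_split g0 (5 * h / 2) (1 - 5 * h / 2) 1 Hc).
set (P := psum _ _) in *. lra.
Qed.

Lemma psum_fourth_powers s : psum (fun i => (7 + 2 * INR i) ^ 4) s
  = 18367 / 15 * INR s + 840 * INR s ^ 2 + 856 / 3 * INR s ^ 3 + 48 * INR s ^ 4
    + 16 / 5 * INR s ^ 5.
Proof. induction s as [|s IH]; [simpl; field|]. cbn [psum]. rewrite IH, S_INR. field. Qed.

Definition error_constant (n : nat) : R :=
  1 / (720 * INR n ^ 4) * (1 + 445 / (32 * INR n)).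

Lemma remainder_monomial n : (7 <= n)%nat ->
  remainder (Qf n) (fun x => x ^ 4 / 24) = error_constant n.
Proof.
intros Hn. replace n with (n - 7 + 7)%nat by lia. set (r := (n - 7)%nat).
unfold remainder. rewrite RInt_monomial, Qf_psum. cbv zeta.
set (h := / INR (r + 7)).
rewrite (psum_ext _ (fun i => h ^ 4 / 384 * (7 + 2 * INR i) ^ 4))
  by (intros; rewrite S_INR; field).
rewrite psum_scal, psum_fourth_powers.
unfold error_constant, h. rewrite plus_INR, (S_INR r). simpl (INR 7).
pose proof (pos_INR r). field. lra.
Qed.

Lemma Qf_ext n f g : (7 <= n)%nat -> (forall x, I01 x -> f x = g x) -> Qf n f = Qf n g.
Proof.
intros Hn H. replace n with (n - 7 + 7)%nat by lia. set (r := (n - 7)%nat).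
rewrite !Qf_psum. cbv zeta. set (h := / INR (r + 7)).
pose proof (pos_INR r) as Hr0.
assert (Hr : (INR r + 7) * h = 1).
{ unfold h. rewrite plus_INR. simpl (INR 7). field. lra. }
assert (Hh : 0 < h) by (apply Rinv_0_lt_compat, lt_0_INR; lia).
assert (Hh7 : 7 * h <= 1) by nra.
rewrite !(H _) by (unfold I01; lra).
rewrite (psum_ext (fun i => f _) (fun i => g (5 * h / 2 + INR (S i) * h))); [reflexivity|].
intros i Hi. apply H. unfold I01. pose proof (pos_INR i).
assert (INR i <= INR r) by (apply le_INR; lia). rewrite S_INR. nra.
Qed.

Lemma Qf_linear n f g s l : (7 <= n)%nat ->
  Qf n (fun x => s * f x - l * g x) = s * Qf n f - l * Qf n g.
Proof.
intros Hn. replace n with (n - 7 + 7)%nat by lia. rewrite !Qf_psum. cbv zeta.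
set (h := / INR (n - 7 + 7)).
rewrite (psum_ext _ (fun i => s * f (5 * h / 2 + INR (S i) * h)
  + (- l) * g (5 * h / 2 + INR (S i) * h))) by (intros; ring).
rewrite psum_plus, !psum_scal. ring.
Qed.

Lemma Qf_positive_definite n : (7 <= n)%nat ->
  positive_definite4_with (Qf n) (error_constant n).
Proof.
intros Hn.
assert (HN : 0 < INR n) by (apply lt_0_INR; lia).
assert (Hc : 0 < error_constant n).
{ unfold error_constant. apply Rmult_lt_0_compat.
  - apply Rdiv_lt_0_compat; [lra|]. apply Rmult_lt_0_compat; [lra|apply pow_lt, HN].
  - assert (0 < 445 / (32 * INR n)) by (apply Rdiv_lt_0_compat; lra). lra. }
split; [exact Hc|]. intros f f4 HC.
destruct (C4_with_smooth4 f f4 HC) as [[f1 [f2 [f3 Hs]]] Hf4].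
set (F := fun x => f (clamp x)) in *. set (F4 := fun x => f4 (clamp x)) in *.
assert (CF4 : continuity F4) by (intros x; apply continuity_pt_filterlim, Hf4).
assert (CF : forall x, continuous F x) by apply Hs.
assert (ER : remainder (Qf n) f = remainder (Qf n) F).
{ assert (EF : forall x, I01 x -> f x = F x).
  { intros x Hx. unfold F. rewrite clamp_id by exact Hx. reflexivity. }
  unfold remainder. rewrite (Qf_ext n f F Hn EF). f_equal.
  apply RInt_ext. rewrite Rmin_left, Rmax_right by lra. intros x Hx.
  apply EF. unfold I01. lra. }
assert (EL : forall s l, remainder (Qf n) (fun x => s * F x - l * (x ^ 4 / 24))
   = s * remainder (Qf n) F - l * error_constant n).
{ intros s l. rewrite <- remainder_monomial by exact Hn. unfold remainder.
  rewrite (Qf_linear n F (fun x => x ^ 4 / 24)) by exact Hn.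
  assert (EI : RInt (fun x => s * F x - l * (x ^ 4 / 24)) 0 1
    = s * RInt F 0 1 - l * RInt (fun x => x ^ 4 / 24) 0 1).
  { assert (Ex : ex_RInt (fun x => x ^ 4 / 24) 0 1).
    { apply (ex_RInt_continuous (V := R_CompleteNormedModule)). intros z _.
      apply (ex_derive_continuous (V := R_NormedModule)). auto_derive. exact I. }
    assert (ExF : ex_RInt F 0 1).
    { apply (ex_RInt_continuous (V := R_CompleteNormedModule)). intros; apply CF. }
    assert (S1 : RInt (fun x => l * (x ^ 4 / 24)) 0 1 = l * RInt (fun x => x ^ 4 / 24) 0 1)
      by exact (RInt_scal (V := R_CompleteNormedModule) (fun x => x ^ 4 / 24) 0 1 l Ex).
    assert (S2 : RInt (fun x => s * F x) 0 1 = s * RInt F 0 1)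
      by exact (RInt_scal (V := R_CompleteNormedModule) F 0 1 s ExF).
    rewrite <- S1, <- S2.
    apply (RInt_minus (V := R_CompleteNormedModule) (fun x => s * F x)
      (fun x => l * (x ^ 4 / 24))).
    - apply (ex_RInt_scal (V := R_NormedModule)), ExF.
    - apply (ex_RInt_scal (V := R_NormedModule)), Ex. }
  rewrite EI. ring. }
destruct (continuity_ab_min F4 0 1 ltac:(lra) ltac:(intros; apply CF4)) as [xm [Hm Im]].
destruct (continuity_ab_maj F4 0 1 ltac:(lra) ltac:(intros; apply CF4)) as [xM [HM IM]].
assert (Hm' : forall x, F4 xm <= F4 x).
{ intros x. replace (F4 x) with (F4 (clamp x)).
  - apply Hm, clamp_I01.
  - unfold F4. rewrite (clamp_id (clamp x)) by apply clamp_I01. reflexivity. }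
assert (HM' : forall x, F4 x <= F4 xM).
{ intros x. replace (F4 x) with (F4 (clamp x)).
  - apply HM, clamp_I01.
  - unfold F4. rewrite (clamp_id (clamp x)) by apply clamp_I01. reflexivity. }
assert (I0 : forall s l, (forall x, 0 <= s * F4 x - l) ->
   0 <= s * remainder (Qf n) F - l * error_constant n).
{ intros s l Hpos. rewrite <- EL.
  exact (remainder_nonneg n _ _ _ _ _ Hn (smooth4_sub_monomial _ _ _ _ _ s l Hs) Hpos). }
pose proof (I0 1 (F4 xm) ltac:(intros x; specialize (Hm' x); lra)) as I1.
pose proof (I0 (-1) (- F4 xM) ltac:(intros x; specialize (HM' x); lra)) as I2.
set (y := remainder (Qf n) F / error_constant n).
assert (Ey : remainder (Qf n) F = error_constant n * y) by (unfold y; field; lra).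
destruct (IVT_gen F4 xm xM y CF4) as [xi [Hxi Exi]].
{ rewrite Ey in I1, I2. rewrite Rmin_left, Rmax_right by apply Hm'. split.
  - apply Rmult_le_reg_l with (error_constant n); [exact Hc|]. lra.
  - apply Rmult_le_reg_l with (error_constant n); [exact Hc|]. lra. }
assert (Ixi : I01 xi).
{ unfold I01. revert Hxi. unfold Rmin, Rmax. repeat destruct Rle_dec; lra. }
exists xi. split; [exact Ixi|].
rewrite ER, Ey, <- Exi. unfold F4. rewrite clamp_id by exact Ixi. reflexivity.
Qed.

(** * Nodes and weights; the optimal constant *)

(** Position of the j-th node in units of 1/(2n), for j <= n. *)
Definition half_step (j : nat) : R := if (j <=? 2)%nat then INR j else 2 * INR j - 3.

Lemma half_step_lt i j : (i < j)%nat -> half_step i < half_step j.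
Proof.
intros H. unfold half_step.
destruct (Nat.leb_spec i 2), (Nat.leb_spec j 2); try lia.
- apply lt_INR, H.
- assert (INR i <= 2) by (replace 2 with (INR 2) by reflexivity; apply le_INR; lia).
  assert (3 <= INR j) by (replace 3 with (INR 3) by (simpl; ring); apply le_INR; lia). lra.
- apply lt_INR in H. lra.
Qed.

(** Weight of the j-th node from the nearest end, in units of 1/n. *)
Definition boundary_weight (j : nat) : R :=
  match j with
  | 1%nat => 251 / 192 | 2%nat => - (43 / 72) | 3%nat => 127 / 96 | 4%nat => 557 / 576
  | _ => 1
  end.

(** The n + 2 nodes, indexed from 1; the last two are mirror images. *)
Definition Qf_node (n i : nat) : R :=
  if (i <=? n)%nat then half_step i / (2 * INR n)
  else 1 - half_step (n + 3 - i) / (2 * INR n).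
Definition Qf_weight (n i : nat) : R := boundary_weight (Nat.min i (n + 3 - i)) / INR n.

Lemma Qf_is_quadrature n : (7 <= n)%nat -> is_quadrature (n + 2) (Qf n).
Proof.
intros Hn. exists (Qf_weight n), (Qf_node n).
assert (HN : 7 <= INR n) by (replace 7 with (INR 7) by (simpl; ring); apply le_INR, Hn).
assert (Hdiv : forall x y, x < y -> x / (2 * INR n) < y / (2 * INR n)).
{ intros x y H. unfold Rdiv. apply Rmult_lt_compat_r; [|exact H]. apply Rinv_0_lt_compat. lra. }
assert (Hmono : forall i j, (1 <= i)%nat -> (i < j)%nat -> (j <= n + 2)%nat ->
   Qf_node n i < Qf_node n j).
{ intros i j Hi Hij Hj. unfold Qf_node.
  destruct (Nat.leb_spec i n), (Nat.leb_spec j n); try lia.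
  - apply Hdiv, half_step_lt, Hij.
  - assert (half_step i <= 2 * INR n - 3).
    { assert (En : half_step n = 2 * INR n - 3).
      { unfold half_step. destruct (Nat.leb_spec n 2); [lia|reflexivity]. }
      rewrite <- En. destruct (Nat.eq_dec i n) as [->|]; [lra|].
      apply Rlt_le, half_step_lt. lia. }
    assert (half_step (n + 3 - j) < 3).
    { replace 3 with (half_step 3) by (unfold half_step; simpl; ring).
      apply half_step_lt. lia. }
    replace (1 - half_step (n + 3 - j) / (2 * INR n))
      with ((2 * INR n - half_step (n + 3 - j)) / (2 * INR n)) by (field; lra).
    apply Hdiv. lra.
  - pose proof (Hdiv _ _ (half_step_lt (n + 3 - j) (n + 3 - i) ltac:(lia))). lra. }
assert (E1 : Qf_node n 1 = 1 / (2 * INR n)).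
{ unfold Qf_node. destruct (Nat.leb_spec 1 n); [|lia]. reflexivity. }
assert (E2 : Qf_node n (n + 2) = 1 - 1 / (2 * INR n)).
{ unfold Qf_node. destruct (Nat.leb_spec (n + 2) n); [lia|].
  replace (n + 3 - (n + 2))%nat with 1%nat by lia. reflexivity. }
assert (0 < 1 / (2 * INR n)) by (apply Rdiv_lt_0_compat; lra).
split; [|split; [exact Hmono|]].
- intros i Hi. unfold I01.
  assert (Qf_node n 1 <= Qf_node n i).
  { destruct (Nat.eq_dec 1 i) as [<-|]; [lra|]. apply Rlt_le, Hmono; lia. }
  assert (Qf_node n i <= Qf_node n (n + 2)).
  { destruct (Nat.eq_dec i (n + 2)) as [->|]; [lra|]. apply Rlt_le, Hmono; lia. }
  lra.
- intros f. rewrite sum_n_m_psum.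
  assert (Er : n = (n - 7 + 7)%nat) by lia.
  set (r := (n - 7)%nat) in Er. rewrite Er at 1. rewrite Qf_psum. cbv zeta.
  rewrite <- Er. set (h := / INR n).
  set (u := fun i => Qf_weight n (S i) * f (Qf_node n (S i))).
  replace (n + 2)%nat with (4 + S r + 4)%nat by lia.
  pose proof (psum_shift u (4 + S r) 4) as T1. pose proof (psum_shift u 4 (S r)) as T2.
  rewrite (psum_ext (fun i => u (4 + i)%nat) (fun i => h * f (5 * h / 2 + INR (S i) * h))) in T2.
  2:{ intros i Hi. unfold u, Qf_weight, Qf_node.
      replace (Nat.min (S (4 + i)) (n + 3 - S (4 + i)))
        with (5 + (Nat.min i (n - 7 - i)))%nat by lia.
      destruct (Nat.leb_spec (S (4 + i)) n); [|lia].
      unfold half_step. destruct (Nat.leb_spec (S (4 + i)) 2); [lia|].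
      cbn [boundary_weight Nat.add]. unfold Rdiv. rewrite Rmult_1_l. fold h.
      f_equal. f_equal. rewrite !S_INR. unfold h. field. lra. }
  rewrite psum_scal in T2.
  assert (U : forall i x, Qf_node n (S i) = x -> forall w, Qf_weight n (S i) = h * w ->
     u i = h * (w * f x)).
  { intros i x <- w Hw. unfold u. rewrite Hw. ring. }
  assert (W : forall i j, Nat.min i (n + 3 - i) = j -> Qf_weight n i = h * boundary_weight j).
  { intros i j <-. unfold Qf_weight, h. field. lra. }
  assert (NL : forall i, (i <= n)%nat -> Qf_node n i = half_step i * h / 2).
  { intros i Hi. unfold Qf_node. destruct (Nat.leb_spec i n); [|lia]. unfold h. field. lra. }
  assert (NR : forall i j, (j + i = n + 3)%nat -> (1 <= j <= 4)%nat ->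
     Qf_node n i = 1 - half_step j * h / 2).
  { intros i j Hij Hj. unfold Qf_node. destruct (Nat.leb_spec i n).
    - unfold half_step. destruct (Nat.leb_spec i 2); [lia|].
      destruct (Nat.leb_spec j 2); [lia|].
      assert (E : INR j + INR i = INR n + 3).
      { rewrite <- plus_INR, Hij, plus_INR. simpl. ring. }
      replace (INR i) with (INR n + 3 - INR j) by lra. unfold h. field. lra.
    - replace (n + 3 - i)%nat with j by lia. unfold h. field. lra. }
  assert (H1 : half_step 1 = 1) by reflexivity. assert (H2 : half_step 2 = 2) by reflexivity.
  assert (H3' : half_step 3 = 3) by (unfold half_step; simpl; ring).
  assert (H4 : half_step 4 = 5) by (unfold half_step; simpl; ring).
  assert (L : psum u 4 = h * (251 / 192 * f (h / 2) - 43 / 72 * f h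
     + 127 / 96 * f (3 * h / 2) + 557 / 576 * f (5 * h / 2))).
  { cbn [psum].
    rewrite (U 0%nat (h / 2)) with (w := 251 / 192);
      [|rewrite NL, H1 by lia; field|apply (W 1 1)%nat; lia].
    rewrite (U 1%nat h) with (w := - (43 / 72));
      [|rewrite NL, H2 by lia; field|apply (W 2 2)%nat; lia].
    rewrite (U 2%nat (3 * h / 2)) with (w := 127 / 96);
      [|rewrite NL, H3' by lia; reflexivity|apply (W 3 3)%nat; lia].
    rewrite (U 3%nat (5 * h / 2)) with (w := 557 / 576);
      [|rewrite NL, H4 by lia; reflexivity|apply (W 4 4)%nat; lia].
    ring. }
  assert (Rr : psum (fun i => u (4 + S r + i)%nat) 4 = h * (251 / 192 * f (1 - h / 2)
     - 43 / 72 * f (1 - h) + 127 / 96 * f (1 - 3 * h / 2) + 557 / 576 * f (1 - 5 * h / 2))).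
  { cbn [psum].
    rewrite (U (4 + S r + 0)%nat (1 - 5 * h / 2)) with (w := 557 / 576);
      [|rewrite (NR _ 4%nat), H4 by lia; reflexivity|apply (W _ 4%nat); lia].
    rewrite (U (4 + S r + 1)%nat (1 - 3 * h / 2)) with (w := 127 / 96);
      [|rewrite (NR _ 3%nat), H3' by lia; reflexivity|apply (W _ 3%nat); lia].
    rewrite (U (4 + S r + 2)%nat (1 - h)) with (w := - (43 / 72));
      [|rewrite (NR _ 2%nat), H2 by lia; field|apply (W _ 2%nat); lia].
    rewrite (U (4 + S r + 3)%nat (1 - h / 2)) with (w := 251 / 192);
      [|rewrite (NR _ 1%nat), H1 by lia; field|apply (W _ 1%nat); lia].
    ring. }
  rewrite L in T2. rewrite Rr in T1.
  transitivity (psum u (4 + S r + 4)); [|reflexivity].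
  lra.
Qed.

Lemma cplus4_bounds n : (7 <= n)%nat ->
  1 / (720 * (INR n + 11) ^ 4) <= cplus4 (n + 2) <= error_constant n.
Proof.
intros Hn. unfold cplus4.
set (E := fun c : R => exists Q : (R -> R) -> R,
    is_quadrature (n + 2) Q /\ positive_definite4 Q /\ c = c4 Q).
destruct (Glb_Rbar_correct E) as [G1 G2].
assert (HE : E (error_constant n)).
{ exists (Qf n). split; [apply Qf_is_quadrature, Hn|].
  pose proof (Qf_positive_definite n Hn) as P. split; [eexists; exact P|].
  symmetry. apply c4_unique, P. }
assert (HL : Rbar_le (1 / (720 * (INR n + 11) ^ 4)) (Glb_Rbar E)).
{ apply G2. intros x [Q [HQ [[c Hc] ->]]]. rewrite (c4_unique Q c Hc). simpl.
  replace (INR n + 11) with (INR (n + 2) + 9) by (rewrite plus_INR; simpl; ring).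
  apply (error_constant_lower_bound _ Q); assumption. }
specialize (G1 _ HE).
destruct (Glb_Rbar E) as [g| |]; simpl in *; try contradiction. split; assumption.
Qed.

(** * The theorem *)

Theorem mainTheorem12 :
  (forall n : nat, (7 <= n)%nat ->
     is_quadrature (n + 2) (Qf n) /\
     positive_definite4 (Qf n) /\
     c4 (Qf n) = 1 / (720 * INR n ^ 4) * (1 + 445 / (32 * INR n))) /\
  is_lim_seq (fun n : nat => c4 (Qf n) / cplus4 (n + 2)) 1.
Proof.
split.
- intros n Hn. pose proof (Qf_positive_definite n Hn) as P.
  split; [apply Qf_is_quadrature, Hn|]. split; [eexists; exact P|].
  exact (c4_unique _ _ P).
- apply (is_lim_seq_le_le_loc (fun _ => 1) _
    (fun n => (1 + 445 / 32 * / INR n) * (1 + 11 * / INR n) ^ 4)).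
  + exists 7%nat. intros n Hn.
    rewrite (c4_unique _ _ (Qf_positive_definite n Hn)).
    destruct (cplus4_bounds n Hn) as [B1 B2].
    assert (HN : 0 < INR n) by (apply lt_0_INR; lia).
    assert (HL : 0 < 1 / (720 * (INR n + 11) ^ 4)).
    { apply Rdiv_lt_0_compat; [lra|]. apply Rmult_lt_0_compat; [lra|]. apply pow_lt. lra. }
    set (p := cplus4 (n + 2)) in *.
    split; apply Rmult_le_reg_r with p; try lra;
      replace (error_constant n / p * p) with (error_constant n) by (field; lra); [lra|].
    replace (error_constant n) with ((1 + 445 / 32 * / INR n) * (1 + 11 * / INR n) ^ 4
      * (1 / (720 * (INR n + 11) ^ 4))) by (unfold error_constant; field; lra).
    assert (0 < / INR n) by (apply Rinv_0_lt_compat, HN).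
    apply Rmult_le_compat_l; [|exact B1].
    apply Rmult_le_pos; [lra|]. apply pow_le. lra.
  + apply is_lim_seq_const.
  + assert (H0 : is_lim_seq (fun n => / INR n) 0).
    { apply (is_lim_seq_inv INR p_infty); [apply is_lim_seq_INR|discriminate]. }
    set (g := fun x => (1 + 445 / 32 * x) * (1 + 11 * x) ^ 4).
    assert (L : is_lim_seq (fun n => g (/ INR n)) (g 0)).
    { apply (is_lim_seq_continuous g (fun n => / INR n) 0); [|exact H0].
      apply continuity_pt_filterlim.
      apply (ex_derive_continuous (V := R_NormedModule)).
      unfold g. auto_derive. exact I. }
    replace (g 0) with 1 in L by (unfold g; ring). exact L.
Qed.
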